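(* Let $\alpha,\beta\in\mathbb{R}$ with $\theta=\alpha\beta\neq0$, and let $f\in\mathbb{C}[\mathbb{H}]$ be such that $f^\theta\neq0$. Then for all $c\in\sigma(\pi_{\alpha,\beta}(f))$ the operators $\pi_{\alpha,\beta}(c-f)$ are injective and have dense range in $L^2(\mathbb{R},\mathbb{C})$, but are not bounded from below.
   Context: $\mathbb{H}$ is the discrete Heisenberg group of upper triangular unipotent $3\times3$ integer matrices, generated by $x=\begin{pmatrix}1&1&0\\0&1&0\\0&0&1\end{pmatrix}$, $y=\begin{pmatrix}1&0&0\\0&1&1\\0&0&1\end{pmatrix}$ and their inverses, with central element $z=xyx^{-1}y^{-1}$. $\mathbb{C}[\mathbb{H}]$ is the complex group ring, i.e. the ring of functions $\mathbb{H}\to\mathbb{C}$ with finite support; its elements are written as finite sums $f=\sum_{(k,l,m)\in\mathbb{Z}^3}f_{(k,l,m)}x^ky^lz^m$ with $f_{(k,l,m)}\in\mathbb{C}$. Define $$f^\theta=\sum_{(k,l,m)\in\mathbb{Z}^3}f_{(k,l,m)}\,x^ky^l e^{2\pi i m\theta}.$$ $\pi_{\alpha,\beta}$ is the unitary representation of $\mathbb{H}$ on $L^2(\mathbb{R},\mathbb{C})$ with $\pi_{\alpha,\beta}(x)=\mathrm{T}_\alpha$, $\pi_{\alpha,\beta}(y)=\mathrm{M}_\beta$, $\pi_{\alpha,\beta}(z)=e^{2\pi i\theta}$, where $(\mathrm{T}_\alpha F)(t)=F(t+\alpha)$ and $(\mathrm{M}_\beta F)(t)=e^{2\pi i\beta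 t}F(t)$ for $F\in L^2(\mathbb{R},\mathbb{C})$ and $t\in\mathbb{R}$; it is extended linearly to $\mathbb{C}[\mathbb{H}]$. $\sigma(\cdot)$ denotes the spectrum in the algebra of bounded linear operators on $L^2(\mathbb{R},\mathbb{C})$; in $c-f$, the scalar $c\in\mathbb{C}$ stands for $c$ times the identity element of $\mathbb{C}[\mathbb{H}]$. An operator $A$ on $L^2(\mathbb{R},\mathbb{C})$ is bounded from below if there is $\delta>0$ with $\|AF\|_2\ge\delta\|F\|_2$ for all $F\in L^2(\mathbb{R},\mathbb{C})$.
   Formalization: The formal theorem also assumes (c-f)^θ ≠ 0, i.e. f^θ is not the constant c; without it the claim fails (f = 1, c = 1 gives π(c-f) = 0), and it fails in every excluded case. *)

(* Defs.v *)
From HB Require Import structures.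
From mathcomp Require Import all_boot all_order all_algebra ring_quotient.
From mathcomp Require Import finmap monalg.
From mathcomp Require Import all_classical all_reals all_analysis.
From mathcomp Require Import measurable_realfun complex.
From mathcomp Require Import ring lra.
Set Implicit Arguments.
Unset Strict Implicit.
Unset Printing Implicit Defensive.
Import Order.TTheory GRing.Theory Num.Theory.
Import numFieldNormedType.Exports.
Local Open Scope classical_set_scope.
Local Open Scope complex_scope.
Local Open Scope ring_scope.

Definition upper_unipotent n (A : 'M[int]_n) : bool :=
  [forall i : 'I_n, forall j : 'I_n,
     (j <= i)%N ==> (A i j == (i == j)%:R)].

Record heis := Heis {
  heis_mx :> 'M[int]_3;
  heis_mxP : upper_unipotent heis_mx }.

HB.instance Definition _ := [isSub for heis_mx].
HB.instance Definition _ := [Choice of heis by <:].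

(* The entries a, b, c are those in positions (1,2), (2,3), (1,3). *)
Definition heis_coord_mx (a b c : int) : 'M[int]_3 :=
  \matrix_(i, j) (nth [::] [:: [:: 1; a; c];
                               [:: 0; 1; b];
                               [:: 0; 0; 1]] i)`_j.

Fact heis_coord_mxP a b c : upper_unipotent (heis_coord_mx a b c).
Proof.
apply/forallP => -[[|[|[|//]]] hi]; apply/forallP => -[[|[|[|//]]] hj];
  by rewrite !mxE.
Qed.

Definition heis_coord a b c : heis := Heis (heis_coord_mxP a b c).

Definition heis_a (h : heis) : int := heis_mx h (inord 0) (inord 1).
Definition heis_b (h : heis) : int := heis_mx h (inord 1) (inord 2).
Definition heis_c (h : heis) : int := heis_mx h (inord 0) (inord 2).

Lemma heis_coordE h : h = heis_coord (heis_a h) (heis_b h) (heis_c h).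
Proof.
apply/val_inj/matrixP => i j; rewrite !mxE.
have := heis_mxP h => /forallP/(_ i)/forallP/(_ j)/implyP.
move: i j => [[|[|[|//]]] hi] [[|[|[|//]]] hj] //= H;
  rewrite ?(eqP (H isT)) //;
  congr (heis_mx h _ _); apply: val_inj; by rewrite /= inordK.
Qed.

Lemma heis_coordK a b c : (heis_a (heis_coord a b c) = a) *
  (heis_b (heis_coord a b c) = b) * (heis_c (heis_coord a b c) = c).
Proof. by rewrite /heis_a /heis_b /heis_c !mxE !inordK. Qed.

Lemma heis_coord_mxM a b c a' b' c' :
  heis_coord_mx a b c *m heis_coord_mx a' b' c' =
  heis_coord_mx (a + a') (b + b') (c + c' + a * b').
Proof.
apply/matrixP => -[[|[|[|//]]] hi] [[|[|[|//]]] hj];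
  rewrite !mxE !big_ord_recl big_ord0 !mxE /=; ring.
Qed.

Fact heis_mulP (g h : heis) : upper_unipotent (g *m h).
Proof.
rewrite (heis_coordE g) (heis_coordE h) heis_coord_mxM.
exact: heis_coord_mxP.
Qed.

Fact heis_oneP : upper_unipotent (1%:M : 'M[int]_3).
Proof.
by apply/forallP => i; apply/forallP => j; rewrite mxE eqxx implybT.
Qed.

Definition heis_mul g h := Heis (heis_mulP g h).
Definition heis_one := Heis heis_oneP.
Definition heis_inv h :=
  heis_coord (- heis_a h) (- heis_b h) (heis_a h * heis_b h - heis_c h).

Lemma heis_one_coord : heis_one = heis_coord 0 0 0.
Proof.
by apply/val_inj/matrixP => -[[|[|[|//]]] hi] [[|[|[|//]]] hj]; rewrite !mxE.
Qed.

Fact heis_mul_coord a b c a' b' c' :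
  heis_mul (heis_coord a b c) (heis_coord a' b' c') =
  heis_coord (a + a') (b + b') (c + c' + a * b').
Proof. exact/val_inj/heis_coord_mxM. Qed.

Fact heis_mulA : associative heis_mul.
Proof. by move=> f g h; apply/val_inj; exact: mulmxA. Qed.
Fact heis_mul1 : left_id heis_one heis_mul.
Proof. by move=> f; apply/val_inj; exact: mul1mx. Qed.
Fact heis_mulr1 : right_id heis_one heis_mul.
Proof. by move=> f; apply/val_inj; exact: mulmx1. Qed.
Fact heis_mulV : left_inverse heis_one heis_inv heis_mul.
Proof.
move=> h; rewrite [X in heis_mul _ X]heis_coordE heis_mul_coord heis_one_coord.
by congr heis_coord; ring.
Qed.
Fact heis_mulrV : right_inverse heis_one heis_inv heis_mul.
Proof.
move=> h; rewrite [X in heis_mul X _]heis_coordE heis_mul_coord heis_one_coord.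
by congr heis_coord; ring.
Qed.

HB.instance Definition _ :=
  isGroup.Build heis heis_mulA heis_mul1 heis_mulr1 heis_mulV heis_mulrV.

Lemma heis_coordM a b c a' b' c' :
  (heis_coord a b c * heis_coord a' b' c')%g =
  heis_coord (a + a') (b + b') (c + c' + a * b').
Proof. exact: heis_mul_coord. Qed.

Lemma heis_coordV a b c :
  (heis_coord a b c)^-1%g = heis_coord (- a) (- b) (a * b - c).
Proof. by rewrite -[LHS]/(heis_inv _) /heis_inv !heis_coordK. Qed.

Definition hx : heis := heis_coord 1 0 0.
Definition hy : heis := heis_coord 0 1 0.
Definition hz : heis := (hx * hy * hx^-1 * hy^-1)%g.

Definition expgz (G : groupType) (g : G) (k : int) : G :=
  match k with Posz n => (g ^+ n)%g | Negz n => (g ^- n.+1)%g end.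

(* The exponents in the normal form h = x^k y^l z^m; since
   x^k y^l = heis_coord k l (k * l), the exponent of z is c - a * b. *)
Definition heis_k (h : heis) : int := heis_a h.
Definition heis_l (h : heis) : int := heis_b h.
Definition heis_m (h : heis) : int := heis_c h - heis_a h * heis_b h.

Lemma hzE : hz = heis_coord 0 0 1.
Proof.
by rewrite /hz !heis_coordV !heis_coordM; congr heis_coord; ring.
Qed.

Lemma expgz_coord (u : int -> heis) (u0 : u 0 = 1%g)
  (uD : forall a b, u (a + b) = (u a * u b)%g) k : expgz (u 1) k = u k.
Proof.
have uX (n : nat) : (u 1%R ^+ n)%g = u n.
  elim: n => [|n IHn]; first by rewrite expg0 u0.
  by rewrite expgS IHn -uD intS.
case: k => n; rewrite /expgz ?uX // NegzE.
by apply: (mulgI (u n.+1)); rewrite mulgV -uD subrr u0.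
Qed.

Lemma heis_normal_coord (k l m : int) :
  (expgz hx k * expgz hy l * expgz hz m)%g = heis_coord k l (m + k * l).
Proof.
rewrite hzE (@expgz_coord (fun k => heis_coord k 0 0)).
- rewrite (@expgz_coord (fun k => heis_coord 0 k 0)).
  + rewrite (@expgz_coord (fun k => heis_coord 0 0 k)) //.
    * by rewrite !heis_coordM; congr heis_coord; ring.
    * by rewrite -heis_one_coord.
    * by move=> a b; rewrite heis_coordM; congr heis_coord; ring.
  + by rewrite -heis_one_coord.
  + by move=> a b; rewrite heis_coordM; congr heis_coord; ring.
- by rewrite -heis_one_coord.
- by move=> a b; rewrite heis_coordM; congr heis_coord; ring.
Qed.

Lemma heis_normalE h :
  h = (expgz hx (heis_k h) * expgz hy (heis_l h) * expgz hz (heis_m h))%g.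
Proof.
by rewrite heis_normal_coord {1}[h]heis_coordE; congr heis_coord; rewrite subrK.
Qed.

Lemma heis_normalK k l m :
  let h := (expgz hx k * expgz hy l * expgz hz m)%g in
  (heis_k h = k) * (heis_l h = l) * (heis_m h = m).
Proof.
rewrite /= heis_normal_coord /heis_k /heis_l /heis_m !heis_coordK.
by split=> //; rewrite addrK.
Qed.

Section L2.
Context d (T : measurableType d) (R : realType).
Variable mu : {measure set T -> \bar R}.
Local Notation C := R[i].
Local Notation re := (@complex.Re R).
Local Notation modulus := (@ComplexField.Normc.normc R).
Local Notation im := (@complex.Im R).

Definition measurable_cfun (F : T -> C) : Prop :=
  measurable_fun setT (re \o F) /\
  measurable_fun setT (im \o F).

(* The L^2 norm in \bar R of a complex-valued function. *)
Definition l2norme (F : T -> C) : \bar R :=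
  'N[mu]_2%:E [EFin \o (modulus \o F)].

Definition sqint : {pred T -> C} :=
  [pred F | `[< measurable_cfun F /\ (l2norme F < +oo)%E >]].

Lemma modulusE (x : C) : modulus x = Num.sqrt (re x ^+ 2 + im x ^+ 2).
Proof. by case: x. Qed.

Lemma modulus_ge0 (x : C) : 0 <= modulus x.
Proof. by rewrite modulusE sqrtr_ge0. Qed.

Lemma modulusD (x y : C) : modulus (x + y) <= modulus x + modulus y.
Proof. by rewrite -lecR rmorphD; exact: ComplexField.lec_normD. Qed.

Lemma measurable_modulus F : measurable_cfun F ->
  measurable_fun setT (modulus \o F).
Proof.
move=> [mr mi]; rewrite (_ : _ \o _ = (fun x : R => x `^ 2^-1) \o
   (fun t => re (F t) ^+ 2 + im (F t) ^+ 2)); last first.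
  by apply/funext => t /=; rewrite modulusE powR12_sqrt ?addr_ge0 ?sqr_ge0.
apply: measurableT_comp; first exact: measurable_powR.
by apply: measurable_funD; exact: measurable_funX.
Qed.

Lemma le_l2norme (f g : T -> R) :
  measurable_fun setT f -> measurable_fun setT g ->
  (forall t, 0 <= f t <= g t) ->
  ('N[mu]_2%:E [EFin \o f] <= 'N[mu]_2%:E [EFin \o g])%E.
Proof.
move=> mf mg fg; rewrite unlock /Lnorm.
have mp (h : T -> R) : measurable_fun setT h ->
    measurable_fun setT (fun t => `|(EFin \o h) t| `^ 2)%E.
  move=> mh; apply: (measurableT_comp (measurable_poweR _)).
  by apply: measurableT_comp => //; exact/measurable_EFinP.
apply: gt0_ler_poweR; first by rewrite invr_ge0.
- by rewrite in_itv/= leey andbT integral_ge0 // => *; exact: poweR_ge0.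
- by rewrite in_itv/= leey andbT integral_ge0 // => *; exact: poweR_ge0.
apply: ge0_le_integral => //;
  [by move=> *; exact: poweR_ge0|exact: mp|exact: mp|].
move=> t _; have /andP[f0 fgt] := fg t.
apply: gt0_ler_poweR => //; rewrite ?in_itv /= ?lee_fin ?andbT ?leey //.
- by rewrite normr_ge0.
- by rewrite normr_ge0.
by rewrite !ger0_norm // (le_trans f0).
Qed.

Lemma l2normeD F G : measurable_cfun F -> measurable_cfun G ->
  measurable_cfun (F + G) ->
  (l2norme (F + G)%R <= l2norme F + l2norme G)%E.
Proof.
move=> mF mG mFG; apply: (@le_trans _ _
  ('N[mu]_2%:E [EFin \o ((modulus \o F) \+ (modulus \o G))%R])%E).
  apply: le_l2norme; first exact: measurable_modulus.
    by apply: measurable_funD; exact: measurable_modulus.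
  by move=> t; rewrite modulus_ge0 modulusD.
by apply: minkowski; rewrite ?ler1n //; exact: measurable_modulus.
Qed.

Lemma measurable_cfunD F G : measurable_cfun F -> measurable_cfun G ->
  measurable_cfun (F + G).
Proof.
move=> [Fr Fi] [Gr Gi]; split.
  rewrite (_ : _ \o _ = (re \o F) \+ (re \o G)).
    exact: measurable_funD.
  by apply/funext => t /=; rewrite raddfD.
rewrite (_ : _ \o _ = (im \o F) \+ (im \o G)).
  exact: measurable_funD.
by apply/funext => t /=; rewrite raddfD.
Qed.

Lemma measurable_cfunM F G : measurable_cfun F -> measurable_cfun G ->
  measurable_cfun (F \* G).
Proof.
move=> [Fr Fi] [Gr Gi]; split.
  rewrite (_ : _ \o _ = ((re \o F) \* (re \o G)) \-
     ((im \o F) \* (im \o G))).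
    by apply: measurable_funB; exact: measurable_funM.
  by apply/funext => t /=; case: (F t) (G t) => [? ?] [].
rewrite (_ : _ \o _ = ((re \o F) \* (im \o G)) \+
     ((im \o F) \* (re \o G))).
    by apply: measurable_funD; exact: measurable_funM.
by apply/funext => t /=; case: (F t) (G t) => [? ?] [].
Qed.

Lemma measurable_cfun_cst a : measurable_cfun (cst a).
Proof. by split; exact: measurable_cst. Qed.

Lemma measurable_cfunZ a F : measurable_cfun F -> measurable_cfun (a *: F).
Proof. by apply: measurable_cfunM; exact: measurable_cfun_cst. Qed.

Lemma l2normeZ a F : F \in sqint -> l2norme (a *: F) = ((modulus a)%:E * l2norme F)%E.
Proof.
move=> /asboolP[mF finF].
have FL : modulus \o F \in @Lfun _ T R mu 2%:E.
  by rewrite inE/=; apply/andP; split; apply/mem_set => //; exact: measurable_modulus.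
have := LnormZ (Lfun_Sub (lee1n 2) FL) (modulus a).
rewrite ger0_norm ?modulus_ge0 // => <-; congr Lnorm.
by apply/funext => t /=; rewrite ComplexField.Normc.normcM.
Qed.

Lemma l2norme0 : l2norme 0 = 0%E.
Proof.
rewrite /l2norme (_ : EFin \o _ = cst 0%E) ?Lnorm0 ?eqe //.
by apply/funext => t; congr EFin; exact: ComplexField.Normc.normc0.
Qed.

Fact sqint_submod_closed : submod_closed sqint.
Proof.
split; first by apply/asboolP; split; [exact: measurable_cfun_cst|rewrite l2norme0 ltey].
move=> a F G hF hG; move: (hF) (hG) => /asboolP[mF fF] /asboolP[mG fG].
have mZ := measurable_cfunZ a mF.
apply/asboolP; split; first exact: measurable_cfunD.
apply: le_lt_trans (l2normeD _ _ _) _ => //; first exact: measurable_cfunD.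
by rewrite l2normeZ // lte_add_pinfty // lte_mul_pinfty ?lee_fin ?modulus_ge0.
Qed.

HB.instance Definition _ := GRing.isSubmodClosed.Build _ _ sqint sqint_submod_closed.

Record L2fun := MkL2fun { l2val :> T -> C; l2valP : l2val \in sqint }.
HB.instance Definition _ := [isSub for l2val].
HB.instance Definition _ := gen_eqMixin L2fun.
HB.instance Definition _ := gen_choiceMixin L2fun.
HB.instance Definition _ := [SubChoice_isSubLmodule of L2fun by <:].

Definition null : {pred L2fun} := [pred F : L2fun | `[< (F : T -> C) = cst 0 %[ae mu] >]].

Fact null_zmod_closed : zmod_closed null.
Proof.
split; first by apply/asboolP; exact: nearW.
move=> F G /asboolP hF /asboolP hG; apply/asboolP.
by apply: filterS2 hF hG => t h1 h2 tT; rewrite -[LHS]/(l2val F t - l2val G t) h1 // h2 // subr0.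
Qed.
HB.instance Definition _ := GRing.isZmodClosed.Build _ null null_zmod_closed.

(* L^2(T, C): square-integrable functions modulo almost everywhere equality. *)
Definition L2 : Type := Quotient.quot null.
HB.instance Definition _ := Choice.on L2.
HB.instance Definition _ := EqQuotient.on L2.
HB.instance Definition _ := GRing.Zmodule.on L2.
Local Open Scope quotient_scope.

Lemma L2_eqP (F G : L2fun) :
  \pi_L2 F = \pi_L2 G <-> (F : T -> C) = G %[ae mu].
Proof.
split.
  move/eqP; rewrite -Quotient.idealrBE => /asboolP.
  by apply: filterS => t FGt tT; apply: subr0_eq; exact: FGt.
move=> FG; apply/eqP; rewrite -Quotient.idealrBE; apply/asboolP.
apply: filterS FG => t FGt tT.
by rewrite -[LHS]/(l2val F t - l2val G t) FGt // subrr.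
Qed.

Lemma L2_reprP (F : L2fun) : (repr (\pi_L2 F) : T -> C) = F %[ae mu].
Proof. by apply/L2_eqP; rewrite reprK. Qed.

Definition L2scale (a : C) (u : L2) : L2 := \pi_L2 (a *: repr u).

Lemma L2scale_pi a F : L2scale a (\pi_L2 F) = \pi_L2 (a *: F).
Proof.
apply/L2_eqP; apply: filterS (L2_reprP F) => t Ft tT.
by rewrite -[LHS]/(a * l2val (repr (\pi_L2 F)) t) Ft.
Qed.

Lemma L2_pi_eq (F G F' G' : L2fun) :
  (forall t, F t = G t -> F' t = G' t) ->
  (F : T -> C) = G %[ae mu] -> \pi_L2 F' = \pi_L2 G'.
Proof.
by move=> FG FGae; apply/L2_eqP; apply: filterS FGae => t FGt tT; exact/FG/FGt.
Qed.

Lemma L2pi_ind (P : L2 -> Prop) : (forall F, P (\pi_L2 F)) -> forall u, P u.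
Proof. by move=> h u; rewrite -[u]reprK. Qed.

Lemma L2piD F G : \pi_L2 (F + G) = \pi_L2 F + \pi_L2 G.
Proof. exact: raddfD. Qed.

Fact L2scaleA a b v : L2scale a (L2scale b v) = L2scale (a * b) v.
Proof.
by elim/L2pi_ind: v => v; rewrite !L2scale_pi scalerA.
Qed.
Fact L2scale1 : left_id 1 L2scale.
Proof. by elim/L2pi_ind => v; rewrite L2scale_pi scale1r. Qed.
Fact L2scaleDr : right_distributive L2scale +%R.
Proof.
move=> a; elim/L2pi_ind => u; elim/L2pi_ind => v.
by rewrite -L2piD !L2scale_pi scalerDr L2piD.
Qed.
Fact L2scaleDl v : {morph L2scale^~ v : a b / a + b}.
Proof.
by move=> a b; elim/L2pi_ind: v => v; rewrite !L2scale_pi scalerDl L2piD.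
Qed.
HB.instance Definition _ :=
  GRing.Zmodule_isLmodule.Build C L2 L2scaleA L2scale1 L2scaleDr L2scaleDl.

Lemma L2piZ a F : \pi_L2 (a *: F) = a *: \pi_L2 F.
Proof. by rewrite -L2scale_pi. Qed.

Definition L2norm (u : L2) : C := (fine (l2norme (repr u)))%:C.

Lemma l2norme_ae (F G : L2fun) : (F : T -> C) = G %[ae mu] ->
  l2norme F = l2norme G.
Proof.
move=> FG; have /asboolP[mF _] := l2valP F; have /asboolP[mG _] := l2valP G.
rewrite /l2norme unlock /Lnorm; congr (_ `^ _)%E.
apply: ge0_ae_eq_integral => //.
- apply: (measurableT_comp (measurable_poweR _)).
  by apply: measurableT_comp => //; exact/measurable_EFinP/measurable_modulus.
- apply: (measurableT_comp (measurable_poweR _)).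
  by apply: measurableT_comp => //; exact/measurable_EFinP/measurable_modulus.
- by move=> *; exact: poweR_ge0.
- by move=> *; exact: poweR_ge0.
by apply: filterS FG => t + tT => /(_ tT) /= ->.
Qed.

Lemma L2norm_pi F : L2norm (\pi_L2 F) = (fine (l2norme F))%:C.
Proof. by rewrite /L2norm (l2norme_ae (L2_reprP F)). Qed.

Lemma l2norme_fin (F : L2fun) : l2norme F \is a fin_num.
Proof.
have /asboolP[_ Fy] := l2valP F.
by rewrite ge0_fin_numE //; exact: Lnorm_ge0.
Qed.

Fact L2normD u v : L2norm (u + v) <= L2norm u + L2norm v.
Proof.
elim/L2pi_ind: u => u; elim/L2pi_ind: v => v.
rewrite -L2piD !L2norm_pi -rmorphD lecR -lee_fin EFinD !fineK ?l2norme_fin //.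
have /asboolP[mF _] := l2valP u; have /asboolP[mG _] := l2valP v.
by apply: l2normeD => //; exact: measurable_cfunD.
Qed.

Fact L2normZ a u : L2norm (a *: u) = `|a| * L2norm u.
Proof.
elim/L2pi_ind: u => u.
rewrite -L2piZ !L2norm_pi /= l2normeZ ?l2valP // fineM ?l2norme_fin //.
by rewrite rmorphM.
Qed.

Fact L2norm0 u : L2norm u = 0 -> u = 0.
Proof.
elim/L2pi_ind: u => u; rewrite L2norm_pi => /(congr1 re) /= u0.
have {}u0 : l2norme u = 0%E by rewrite -[LHS]fineK ?l2norme_fin // u0.
have /asboolP[mF _] := l2valP u.
rewrite -[RHS](raddf0 (\pi_L2)); apply/L2_eqP.
have := Lnorm_eq0_eq0 _ _ u0 => /(_ _ _).
have mm : measurable_fun setT (EFin \o (modulus \o u)).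
  exact/measurable_EFinP/measurable_modulus.
move=> /(_ mm); rewrite lte_fin ltr0n => /(_ isT).
by apply: filterS => t + tT => /(_ tT) [] /ComplexField.Normc.eq0_normc.
Qed.

HB.instance Definition _ := Lmodule_isNormed.Build C L2 L2normD L2normZ L2norm0.

End L2.

Section Operators.
Context (K : numFieldType) (V : normedModType K).

(* Resolvent points are the c for which c - A has an inverse among the bounded
   operators; for linear maps, bounded and continuous are the same. *)
Definition spectrum (A : {linear V -> V}) : set K :=
  [set c | ~ exists B : {linear V -> V},
     [/\ continuous B,
         forall v, B (c *: v - A v) = v &
         forall v, c *: B v - A (B v) = v]].

Definition bounded_from_below (A : V -> V) : Prop :=
  exists2 delta : K, 0 < delta & forall v, delta * `|v| <= `|A v|.

End Operators.

Section TimeFrequency.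
Context (R : realType).
Local Notation C := R[i].
Local Notation leb := (@lebesgue_measure R).
Local Notation H := (L2 leb).
Local Notation Hfun := (L2fun leb).
Local Open Scope quotient_scope.

(* expi s = e^(2 pi i s) *)
Definition expi (s : R) : C := cos (2 * pi * s) +i* sin (2 * pi * s).

Lemma expiD s t : expi (s + t) = expi s * expi t.
Proof.
rewrite /expi !mulrDr cosD sinD; simpc; congr (_ +i* _).
by rewrite [RHS]addrC.
Qed.

Lemma expi0 : expi 0 = 1.
Proof. by rewrite /expi mulr0 cos0 sin0. Qed.

Lemma modulus_expi s : ComplexField.Normc.normc (expi s) = 1.
Proof. by rewrite /= cos2Dsin2 sqrtr1. Qed.

Lemma normr_expi s : `|expi s| = 1.
Proof. by rewrite -[LHS]/(_%:C) modulus_expi. Qed.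

Let measurable_shift (a : R) : measurable_fun setT (fun t : R => t + a).
Proof. by apply: measurable_funD. Qed.

Lemma lebesgue_shift (a : R) (A : set R) : measurable A ->
  leb ((fun t => t + a) @^-1` A) = leb A.
Proof.
move=> mA; pose phi := (fun t : measurableTypeR R => (t + a : measurableTypeR R)).
have mphi : measurable_fun setT phi := measurable_shift a.
pose phim : {mfun measurableTypeR R >-> measurableTypeR R} :=
  HB.pack phi (isMeasurableFun.Build _ _ _ _ _ mphi).
rewrite -[LHS]/(pushforward leb phim A); symmetry.
apply: (@lebesgue_measure_unique R (pushforward leb phim)) => // _ [[x y] _ <-] /=.
rewrite /pushforward (_ : phim @^-1` _ = `]x - a, y - a]%classic); last first.
  by apply/seteqP; split=> t /=; rewrite !in_itv /= ltrBlDr lerBrDr.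
rewrite !lebesgue_measure_itv /= !lte_fin ltrD2r; case: ifP => // _.
by rewrite -!EFinB; congr EFin; ring.
Qed.

Lemma ge0_integral_shift (a : R) (g : R -> \bar R) :
  measurable_fun setT g -> (forall t, 0 <= g t)%E ->
  (\int[leb]_t g (t + a)%R = \int[leb]_t g t)%E.
Proof.
move=> mg g0.
pose phi := (fun t : measurableTypeR R => (t + a : measurableTypeR R)).
have mphi : measurable_fun setT phi := measurable_shift a.
have := @ge0_integral_pushforward _ _ _ _ _ _ mphi leb setT g measurableT mg
  (fun t _ => g0 t).
rewrite preimage_setT => <-.
apply: eq_measure_integral => A mA _; exact: lebesgue_shift.
Qed.

Lemma ae_shift (a : R) (P : R -> Prop) :
  (\forall t \ae leb, P t) -> \forall t \ae leb, P (t + a).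
Proof.
move=> [N [mN N0 PN]]; exists ((fun t => t + a) @^-1` N); split.
- by rewrite -[X in measurable X]setTI; exact: measurable_shift.
- by rewrite lebesgue_shift.
- by move=> t; exact: PN.
Qed.

Lemma l2norme_shift (a : R) (F : R -> C) : measurable_cfun F ->
  l2norme leb (fun t => F (t + a)) = l2norme leb F.
Proof.
move=> mF; rewrite /l2norme unlock /Lnorm; congr (_ `^ _)%E.
apply: (ge0_integral_shift a
  (g := fun t => (`|((@ComplexField.Normc.normc R (F t))%:E)| `^ 2)%E)).
  apply: (measurableT_comp (measurable_poweR _)).
  by apply: measurableT_comp => //; exact/measurable_EFinP/measurable_modulus.
by move=> t; exact: poweR_ge0.
Qed.

Fact translate_subproof (a : R) (F : Hfun) :
  (fun t => F (t + a)) \in sqint leb.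
Proof.
have /asboolP[mF finF] := l2valP F.
apply/asboolP; split; last by rewrite l2norme_shift.
case: mF => mr mi; split.
  exact: (measurableT_comp mr (measurable_shift a)).
exact: (measurableT_comp mi (measurable_shift a)).
Qed.
Definition translate_fun a F : Hfun := MkL2fun (translate_subproof a F).

Lemma measurable_expi (b : R) :
  measurable_cfun (fun t : R => expi (b * t)).
Proof.
have mb : measurable_fun setT (fun t : R => 2 * pi * (b * t)).
  by apply: measurable_funM => //; apply: measurable_funM.
split.
- apply: (measurableT_comp _ mb); apply: continuous_measurable_fun.
  exact: continuous_cos.
- apply: (measurableT_comp _ mb); apply: continuous_measurable_fun.
  exact: continuous_sin.
Qed.

Lemma l2norme_modulate (b : R) (F : R -> C) :
  l2norme leb (fun t => expi (b * t) * F t) = l2norme leb F.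
Proof.
rewrite /l2norme; congr Lnorm; apply/funext => t /=.
by rewrite ComplexField.Normc.normcM modulus_expi mul1r.
Qed.

Fact modulate_subproof (b : R) (F : Hfun) :
  (fun t => expi (b * t) * F t) \in sqint leb.
Proof.
have /asboolP[mF finF] := l2valP F.
apply/asboolP; split; last by rewrite l2norme_modulate.
exact: (measurable_cfunM (measurable_expi b) mF).
Qed.
Definition modulate_fun b F : Hfun := MkL2fun (modulate_subproof b F).

Definition translate (a : R) (u : H) : H := \pi_H (translate_fun a (repr u)).
Definition modulate (b : R) (u : H) : H := \pi_H (modulate_fun b (repr u)).

Lemma translate_pi a F : translate a (\pi_H F) = \pi_H (translate_fun a F).
Proof.
apply/L2_eqP; exact: (ae_shift a (L2_reprP F)).
Qed.

Lemma modulate_pi b F : modulate b (\pi_H F) = \pi_H (modulate_fun b F).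
Proof.
by apply: L2_pi_eq (L2_reprP F) => t Ft; congr (_ * _).
Qed.

Fact translate_linear a : linear (translate a).
Proof.
move=> c; elim/L2pi_ind => F; elim/L2pi_ind => G.
rewrite -L2piZ -L2piD !translate_pi -L2piZ -L2piD.
by congr (\pi_H _); exact/val_inj.
Qed.
HB.instance Definition _ a :=
  GRing.isLinear.Build C H H _ (translate a) (translate_linear a).

Fact modulate_linear b : linear (modulate b).
Proof.
move=> c; elim/L2pi_ind => F; elim/L2pi_ind => G.
rewrite -L2piZ -L2piD !modulate_pi -L2piZ -L2piD.
congr (\pi_H _); apply/val_inj/funext => t /=.
by rewrite -[LHS]/(_ * (c * F t + G t)) mulrDr mulrCA.
Qed.
HB.instance Definition _ b :=
  GRing.isLinear.Build C H H _ (modulate b) (modulate_linear b).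

Lemma L2normE F : `|\pi_H F| = (fine (l2norme leb F))%:C.
Proof. exact: L2norm_pi. Qed.

Lemma translate_isometry a u : `|translate a u| = `|u|.
Proof.
elim/L2pi_ind: u => F; rewrite translate_pi !L2normE l2norme_shift //.
by have /asboolP[] := l2valP F.
Qed.

Lemma modulate_isometry b u : `|modulate b u| = `|u|.
Proof.
by elim/L2pi_ind: u => F; rewrite modulate_pi !L2normE l2norme_modulate.
Qed.

Section Representation.
Variables alpha beta : R.
Local Notation theta := (alpha * beta).

(* pi_{alpha,beta} (x^k y^l z^m) = e^(2 pi i m theta) T_alpha^k M_beta^l, with
   T_alpha^k = T_(k alpha) and M_beta^l = M_(l beta). The lemmas heis_rep1,
   heis_repM, heis_rep_hx, heis_rep_hy and heis_rep_hz below characterise it as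
   the representation with pi(x) = T_alpha, pi(y) = M_beta, pi(z) = e^(2 pi i theta). *)
Definition heis_rep (h : heis) (u : H) : H :=
  expi ((heis_m h)%:~R * theta) *:
    translate ((heis_k h)%:~R * alpha) (modulate ((heis_l h)%:~R * beta) u).

Fact heis_rep_linear h : linear (heis_rep h).
Proof.
by move=> c u v; rewrite /heis_rep (linearP (modulate _)) (linearP (translate _)) scalerDr !scalerA [c * _]mulrC.
Qed.
HB.instance Definition _ h :=
  GRing.isLinear.Build C H H _ (heis_rep h) (heis_rep_linear h).

Lemma heis_rep_pi h (F : Hfun) : exists2 G : Hfun, heis_rep h (\pi_H F) = \pi_H G &
  forall t, G t = expi ((heis_m h)%:~R * theta +
     (heis_l h)%:~R * beta * (t + (heis_k h)%:~R * alpha)) *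
       F (t + (heis_k h)%:~R * alpha).
Proof.
exists (expi ((heis_m h)%:~R * theta) *:
    translate_fun ((heis_k h)%:~R * alpha) (modulate_fun ((heis_l h)%:~R * beta) F)).
  by rewrite /heis_rep modulate_pi translate_pi L2piZ.
by move=> t; rewrite expiD -mulrA.
Qed.

Lemma heis_rep_isometry h u : `|heis_rep h u| = `|u|.
Proof.
by rewrite normrZ normr_expi mul1r translate_isometry modulate_isometry.
Qed.

Lemma heis_repM g h u : heis_rep (g * h)%g u = heis_rep g (heis_rep h u).
Proof.
elim/L2pi_ind: u => F.
have [G1 -> G1E] := heis_rep_pi h F; have [G2 -> G2E] := heis_rep_pi g G1.
have [G3 -> G3E] := heis_rep_pi (g * h)%g F.
congr (\pi_H _); apply/val_inj/funext => t /=; rewrite G3E G2E G1E mulrA -expiD.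
rewrite /heis_m /heis_k /heis_l (heis_coordE g) (heis_coordE h) heis_coordM.
rewrite !heis_coordK; move: (heis_a _) (heis_b _) (heis_c _) => a b c.
move: (heis_a _) (heis_b _) (heis_c _) => a' b' c'.
congr (expi _ * F _).
  by rewrite !(intrD, intrM, mulrzDr, rmorphB, rmorphD, rmorphM) /=; ring.
by rewrite rmorphD /=; ring.
Qed.

Lemma heis_rep1 u : heis_rep 1%g u = u.
Proof.
elim/L2pi_ind: u => F; have [G -> GE] := heis_rep_pi 1%g F.
congr (\pi_H _); apply/val_inj/funext => t; rewrite /= GE -[1%g]/heis_one heis_one_coord.
rewrite /heis_m /heis_k /heis_l !heis_coordK mulr0 subrr !mul0r !addr0.
by rewrite expi0 mul1r.
Qed.

Lemma heis_rep_hx u : heis_rep hx u = translate alpha u.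
Proof.
elim/L2pi_ind: u => F; have [G -> GE] := heis_rep_pi hx F; rewrite translate_pi.
congr (\pi_H _); apply/val_inj/funext => t; rewrite /= GE /= /heis_m /heis_k /heis_l.
by rewrite !heis_coordK mulr0 subrr !mul0r !addr0 expi0 !mul1r.
Qed.

Lemma heis_rep_hy u : heis_rep hy u = modulate beta u.
Proof.
elim/L2pi_ind: u => F; have [G -> GE] := heis_rep_pi hy F; rewrite modulate_pi.
congr (\pi_H _); apply/val_inj/funext => t; rewrite /= GE /= /heis_m /heis_k /heis_l.
by rewrite !heis_coordK !(mul0r, subr0, oppr0, addr0, add0r, mul1r).
Qed.

Lemma heis_rep_hz u : heis_rep hz u = expi theta *: u.
Proof.
elim/L2pi_ind: u => F; have [G -> GE] := heis_rep_pi hz F; rewrite -L2piZ.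
congr (\pi_H _); apply/val_inj/funext => t; rewrite /= GE /= hzE /heis_m /heis_k /heis_l.
by rewrite !heis_coordK !(mul0r, subr0, oppr0, addr0, add0r, mul1r).
Qed.

(* malg heis R[i] is the group ring C[H] as a C-module, the finitely supported
   functions H -> C; its identity element is << 1%g >>. The convolution product
   of monalg needs a monomType, which excludes groups, and is not used here. *)
Definition group_ring_rep (f : malg heis C) (u : H) : H :=
  \sum_(h <- msupp f) f@_h *: heis_rep h u.

Fact group_ring_rep_linear f : linear (group_ring_rep f).
Proof.
move=> c u v; rewrite /group_ring_rep scaler_sumr -big_split /=.
by apply: eq_bigr => h _; rewrite (linearP (heis_rep h)) scalerDr !scalerA [c * _]mulrC.
Qed.
HB.instance Definition _ f :=
  GRing.isLinear.Build C H H _ (group_ring_rep f) (group_ring_rep_linear f).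

Lemma group_ring_rep_continuous f : continuous (group_ring_rep f).
Proof.
apply: bounded_linear_continuous; apply/bounded_funP => r.
exists (\sum_(h <- msupp f) `|f@_h| * r) => u ur.
apply: le_trans (ler_norm_sum _ _ _) _; apply: ler_sum => h _.
by rewrite normrZ heis_rep_isometry ler_wpM2l.
Qed.

End Representation.

(* f^theta = sum f_(k,l,m) e^(2 pi i m theta) x^k y^l, a finitely supported
   function of the exponents (k, l). *)
Definition twist (theta : R) (f : malg heis C) : malg (int * int)%type C :=
  \sum_(h <- msupp f)
    << f@_h * expi ((heis_m h)%:~R * theta) *g (heis_k h, heis_l h) >>.

End TimeFrequency.

(* Main.v *)
(* Restricted to a coset t + alpha Z, an element of the kernel of pi(g) is an
   l^2 sequence solving a linear recurrence of some fixed order m, whose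
   leading coefficient vanishes nowhere on the coset for almost every t.
   Translates by Z / beta of a kernel element are again in the kernel, with the
   same recurrence. If rho(s) is the largest value of |F(s)|^2 among these
   translates F, normalised on their cosets, then rho has sum at most m over
   almost every coset of alpha Z, since the solution space has dimension at
   most m; hence rho is integrable over R. But rho is periodic with period 1 /
   beta, so it vanishes (Demeter and Gautam's proof of Linnell's theorem). The
   adjoint of pi(g) is an operator of the same kind, so it is also injective
   and pi(g) has dense range. If it were bounded from below, it would be
   surjective with a bounded inverse. *)
Require Import Defs.
From HB Require Import structures.
From mathcomp Require Import all_boot all_order all_algebra.
From mathcomp Require Import spectral sesquilinear.
From mathcomp Require Import finmap monalg.
From mathcomp Require Import all_classical all_reals all_analysis.
From mathcomp Require Import measurable_realfun complex.
From mathcomp Require Import ring lra zify.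
Set Implicit Arguments.
Unset Strict Implicit.
Unset Printing Implicit Defensive.
Import Order.TTheory GRing.Theory Num.Theory.
Import numFieldNormedType.Exports.
Local Open Scope classical_set_scope.
Local Open Scope ring_scope.

(** * Local densities of recurrence solutions *)

Section Energy.
Local Open Scope sesquilinear_scope.
Variable C : numClosedFieldType.

Lemma dotmx_sum n (u : 'rV[C]_n) : dotmx u u = \sum_i `|u 0 i| ^+ 2.
Proof.
by rewrite dotmxE mxE; apply: eq_bigr => i _; rewrite !mxE normCK.
Qed.

(** For orthonormal rows [U] whose span contains that of [E], [w n] is the squared norm of column
    [n], a diagonal entry of the orthogonal projection. The trace is [m], and Cauchy-Schwarz bounds
    each entry of [u]. *)
Lemma submx_energy m L (E : 'M[C]_(m, L)) :
  exists w : 'I_L -> C, [/\ forall n, 0 <= w n, \sum_n w n <= m%:R &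
    forall u : 'rV_L, (u <= E)%MS -> \sum_n `|u 0 n| ^+ 2 <= 1 ->
      forall n, `|u 0 n| ^+ 2 <= w n].
Proof.
(* When [L < m] there are no [m] orthonormal rows, but the constant weight 1 has sum [L]. *)
have [mL|Lm] := leqP m L; last first.
  exists (fun=> 1); split=> //.
    by rewrite sumr_const card_ord ler_nat ltnW.
  move=> u _ u1 n; apply: le_trans u1.
  by rewrite (bigD1 n) //= lerDl sumr_ge0 // => i _; rewrite exprn_ge0.
have := schmidt_unitarymx E mL; set U := schmidt E => /unitarymxP UU.
have colE n : dotmx (col n U)^T (col n U)^T = \sum_i `|U i n| ^+ 2.
  by rewrite dotmx_sum; apply: eq_bigr => i _; rewrite !mxE.
exists (fun n => \sum_i `|U i n| ^+ 2); split.
- by move=> n; rewrite sumr_ge0 // => i _; rewrite exprn_ge0.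
- rewrite exchange_big /= (eq_bigr (fun=> 1)); first by rewrite sumr_const card_ord.
  move=> i _; have /matrixP/(_ i i) := UU; rewrite !mxE eqxx mulr1n => <-.
  by apply: eq_bigr => j _; rewrite !mxE normCK.
move=> u /submx_trans/(_ (schmidt_sub E))/submxP[c ->] u1 n.
have cE : dotmx c c = dotmx (c *m U) (c *m U).
  by rewrite !dotmxE trmx_mul map_mxM mulmxA -[c *m U *m _]mulmxA UU mulmx1.
set v := map_mx Num.conj (col n U)^T.
have CS : `|dotmx c v| ^+ 2 <= dotmx c c * dotmx v v.
  exact: (CauchySchwarz (@dotmx C m) c v).1.
have cv : dotmx c v = (c *m U) 0 n.
  by rewrite dotmxE !mxE; apply: eq_bigr => i _; rewrite !mxE conjCK.
rewrite cv cE !dotmx_sum in CS; apply: le_trans CS _.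
rewrite [X in _ * X](eq_bigr (fun i => `|U i n| ^+ 2)); last first.
  by move=> i _; rewrite !mxE norm_conjC.
by rewrite ler_piMl // sumr_ge0 // => i _; rewrite exprn_ge0.
Qed.

(* A recurrence of order m with nonvanishing leading coefficient has an
   m-dimensional solution space, so that the local densities w add up to at most m. *)
Lemma recurrence_energy m L (a : nat -> nat -> C) : (forall n, a n m != 0) ->
  exists w : 'I_L -> C, [/\ forall n, 0 <= w n, \sum_n w n <= m%:R &
    forall v : nat -> C, (forall n, \sum_(k < m.+1) a n k * v (n + k)%N = 0) ->
      \sum_(n < L) `|v n| ^+ 2 <= 1 -> forall n : 'I_L, `|v n| ^+ 2 <= w n].
Proof.
move=> am; pose sol v := forall n, \sum_(k < m.+1) a n k * v (n + k)%N = 0.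
(* Solving for the leading term, every value is a combination of the first [m], with coefficients
   common to all solutions. *)
have initial n : exists e : 'I_m -> C, forall v, sol v -> v n = \sum_(i < m) v i * e i.
  elim/ltn_ind: n => n IH; have [nm|mn] := ltnP n m.
    exists (fun i => (i == Ordinal nm)%:R) => v _.
    rewrite (bigD1 (Ordinal nm)) //= eqxx mulr1 big1 ?addr0 // => i /negbTE ->.
    by rewrite mulr0.
  have {IH} [e eP] : {e : 'I_m -> 'I_m -> C &
      forall (k : 'I_m) v, sol v -> v (n - m + k)%N = \sum_(i < m) v i * e k i}.
    apply: (@choice _ _ (fun (k : 'I_m) e => forall v, sol v ->
      v (n - m + k)%N = \sum_(i < m) v i * e i)) => k.
    by apply: IH; rewrite -[X in (_ < X)%N](subnK mn) ltn_add2l.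
  exists (fun i => - ((a (n - m)%N m)^-1 * \sum_(k < m) a (n - m)%N k * e k i)).
  move=> v vsol; have := vsol (n - m)%N; rewrite big_ord_recr /= subnK // => /eqP.
  rewrite addrC addr_eq0 => /eqP vE.
  apply: (mulfI (am (n - m)%N)); rewrite vE mulr_sumr -sumrN.
  under eq_bigr do rewrite eP // mulr_sumr -sumrN.
  rewrite exchange_big /=; apply: eq_bigr => i _.
  rewrite mulrCA mulrN mulVKf // mulrN mulr_sumr -sumrN.
  by apply: eq_bigr => k _; rewrite mulrCA.
have [e eP] := choice initial.
(* Every solution, cut to [L] terms, is a combination of the [m] rows of this matrix. *)
have [w [w0 wm wP]] := submx_energy (\matrix_(i < m, n < L) e n i).
exists w; split=> // v vsol v1 n.
have -> : v n = (\row_(i < L) v i) 0 n by rewrite mxE.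
apply: wP; last by under eq_bigr do rewrite mxE.
apply/submxP; exists (\row_i v i); apply/rowP => j; rewrite !mxE eP //.
by apply: eq_bigr => i _; rewrite !mxE.
Qed.

End Energy.

(** * Zeros of trigonometric polynomials *)

Section TrigonometricPolynomials.
Variable R : realType.

Lemma expiN (s : R) : expi (- s) = (expi s)^-1.
Proof.
have e0 : expi s != 0 by rewrite -normr_eq0 normr_expi oner_eq0.
by apply: (mulfI e0); rewrite -expiD subrr expi0 divff.
Qed.

Lemma expi_natmul (s : R) n : expi (n%:R * s) = expi s ^+ n.
Proof.
elim: n => [|n IH]; first by rewrite mul0r expi0 expr0.
by rewrite -[in LHS]natr1 mulrDl mul1r expiD IH exprSr.
Qed.

Lemma expi1 : expi (1 : R) = 1.
Proof.
by rewrite /expi mulr1 mulr_natl cos2pi sin2pi.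
Qed.

Lemma expi_int (n : int) : expi (n%:~R : R) = 1.
Proof.
case: n => n; first by rewrite -[_%:~R]mulr1 expi_natmul expi1 expr1n.
by rewrite NegzE mulrNz expiN -[_%:~R]mulr1 expi_natmul expi1 expr1n invr1.
Qed.

(** For the fractional part [r] of [s], the number [1 - cos (2 pi r) = 2 sin (pi r)^2] vanishes,
    while [sin (pi r) > 0] if [0 < r < 1]. *)
Lemma expi_eq1 (s : R) : expi s = 1 -> s = (Num.floor s)%:~R.
Proof.
move=> s1; set n := Num.floor s; pose r := s - n%:~R.
have : expi r = 1 by rewrite expiD s1 -rmorphN /= expi_int mulr1.
have /andP[r0 r1] : 0 <= r < 1.
  by have := floor_itv s; rewrite -/n intrD /r; lra.
case=> cr _; apply/eqP; rewrite -subr_eq0 -/r; apply: contraT => rn0.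
have rp : 0 < r by rewrite lt_def rn0.
have p0 := pi_gt0 R.
have /lt0r_neq0 : 0 < sin (pi * r).
  by apply: sin_gt0_pi; rewrite mulr_gt0 //= gtr_pMr.
have : sin (pi * r) ^+ 2 == 0.
  have : cos (pi * r *+ 2) = 1 by rewrite -cr; congr cos; ring.
  rewrite cos_mulr2n => c2; have := cos2Dsin2 (pi * r); lra.
by rewrite sqrf_eq0 => ->.
Qed.

Local Notation leb := (@lebesgue_measure R).

(** Two solutions differ by an integer multiple of [1 / beta], so the exceptional set is
    countable. *)
Lemma expi_neq_ae (beta : R) (z : R[i]) : beta != 0 ->
  \forall t \ae leb, expi (beta * t) != z.
Proof.
move=> b0; pose Z := [set t | expi (beta * t) = z].
have [[t0 t0z]|Z0] := pselect (exists t0, Z t0); last first.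
  by apply: nearW => t; apply/eqP => tz; apply: Z0; exists t.
have cZ : countable Z.
  apply: (@sub_countable _ _ _ (range (fun n : int => t0 + n%:~R / beta))).
    apply: subset_card_le => t /= tz.
    exists (Num.floor (beta * (t - t0))) => //.
    rewrite -expi_eq1; first by field.
    rewrite mulrBr expiD expiN tz -t0z divff //.
    by rewrite -normr_eq0 normr_expi oner_eq0.
  exact: (sub_countable (card_image_le _ _)).
exists Z; split.
- exact: countable_measurable.
- exact: countable_lebesgue_measure0.
- by move=> t /= /negP/negPn/eqP.
Qed.

(** Multiplied by [expi (K beta t)], the sum becomes a nonzero polynomial in [expi (beta t)], whose
    finitely many roots are avoided almost everywhere. *)
Lemma trig_poly_neq0_ae (beta : R) (S : seq int) (d : int -> R[i]) l0 :
  beta != 0 -> uniq S -> l0 \in S -> d l0 != 0 ->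
  \forall t \ae leb, \sum_(l <- S) d l * expi (l%:~R * beta * t) != 0.
Proof.
move=> b0 uS l0S dl0; pose K := \sum_(l <- S) `|l|%N.
have lK l : l \in S -> 0 <= l + K%:Z.
  move=> lS; have : (`|l| <= K)%N by rewrite /K (big_rem l) //= leq_addr.
  lia.
pose p : {poly R[i]} := \sum_(l <- S) d l *: 'X^(absz (l + K%:Z)).
have p0 : p != 0.
  apply/eqP => /polyP/(_ (absz (l0 + K%:Z))) /eqP.
  rewrite coef0 coef_sum (big_rem l0) //= coefZ coefXn eqxx mulr1 big_seq big1 ?addr0.
    by apply/negP.
  move=> l; rewrite mem_rem_uniq // inE => /andP[ll0 lS].
  rewrite coefZ coefXn; case: eqP => [e|]; last by rewrite mulr0.
  by have := lK _ l0S; have := lK _ lS; move/eqP: ll0; lia.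
have [rs pE] := closed_field_poly_normal p.
(* Past the end of [rs], [nth] gives 0, which [expi_neq_ae] excludes as well. *)
have := ae_foralln (fun n => expi_neq_ae (nth 0 rs n) b0).
apply: filterS => t trs; apply/eqP => sum0.
have : root p (expi (beta * t)).
  apply/rootP; rewrite /p horner_sum.
  transitivity (expi (K%:R * (beta * t)) * \sum_(l <- S) d l * expi (l%:~R * beta * t)).
    rewrite mulr_sumr !big_seq; apply: eq_bigr => l lS.
    rewrite hornerZ hornerXn -expi_natmul [RHS]mulrCA -expiD; congr (_ * expi _).
    rewrite pmulrn gez0_abs ?lK // intrD; ring.
  by rewrite sum0 mulr0.
rewrite pE rootZ ?lead_coef_eq0 // root_prod_XsubC => /(nthP 0)[n _ ne].
by have := trs n; rewrite ne eqxx.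
Qed.

End TrigonometricPolynomials.

(** * Unfolding integrals over cosets *)

Section Unfolding.
Variable R : realType.
Local Notation leb := (@lebesgue_measure R).

(* filterS fails to find its Filter instance on predicates over R, since the
   carrier of lebesgue_measure is an alias of R. *)
Lemma ae_mono (P Q : R -> Prop) : (\forall t \ae leb, P t) ->
  (forall t, P t -> Q t) -> \forall t \ae leb, Q t.
Proof.
move=> [N [mN N0 PN]] PQ; exists N; split=> // t Qt; apply: PN => Pt.
exact/Qt/PQ.
Qed.

Lemma ae_and (P Q : R -> Prop) : (\forall t \ae leb, P t) ->
  (\forall t \ae leb, Q t) -> \forall t \ae leb, P t /\ Q t.
Proof.
move=> hP hQ; have h n : \forall t \ae leb, (if n is 0%N then P else Q) t by case: n.
by have := ae_foralln h; move/ae_mono; apply=> t ht; split; [exact: (ht 0%N)|exact: (ht 1%N)].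
Qed.

Lemma ae_forall_int (P : int -> R -> Prop) :
  (forall n, \forall t \ae leb, P n t) -> \forall t \ae leb, forall n, P n t.
Proof.
move=> h; have := ae_foralln (fun n => h (odflt 0 (choice.unpickle n))).
by move/ae_mono; apply=> t ht n; have := ht (choice.pickle n); rewrite choice.pickleK.
Qed.

Lemma floor_remainder (a t : R) : 0 < a ->
  0 <= t - (Num.floor (t / a))%:~R * a < a.
Proof.
move=> a0; have /andP[] := floor_itv (t / a).
rewrite ler_pdivlMr // ltr_pdivrMr // intrD mulrDl mul1r; lra.
Qed.

(** Every point is a translate of a point of [[0, a[], so the exceptional set lies in countably many
    translates of a null set. *)
Lemma ae_periodic_pos (a : R) (P : R -> Prop) : 0 < a ->
  (forall t, P t -> forall n : int, P (t + n%:~R * a)) ->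
  (\forall t \ae leb, `[0, a[%classic t -> P t) -> \forall t \ae leb, P t.
Proof.
move=> a0 Pa hP.
have : \forall t \ae leb, forall n : int, `[0, a[%classic (t - n%:~R * a) -> P (t - n%:~R * a).
  by apply: ae_forall_int => n; exact: (ae_shift (- (n%:~R * a)) hP).
move/ae_mono; apply => t /(_ (Num.floor (t / a))).
rewrite /= in_itv /= floor_remainder // => /(_ isT)/Pa/(_ (Num.floor (t / a))).
by rewrite subrK.
Qed.

Lemma ae_periodic (a : R) (P : R -> Prop) : a != 0 ->
  (forall t, P t -> forall n : int, P (t + n%:~R * a)) ->
  (\forall t \ae leb, `[0, `|a|[%classic t -> P t) -> \forall t \ae leb, P t.
Proof.
move=> a0 Pa; apply: ae_periodic_pos; first by rewrite normr_gt0.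
move=> t Pt n; have [_|_] := ger0P a; first exact: Pa.
by have := Pa t Pt (- n); rewrite mulrNz mulNr mulrN.
Qed.

(** Turns sums over [int] into series over [nat], to which the measurability and exchange results
    for series apply. *)
Lemma int_enumeration : exists e : nat -> int, set_bij [set: nat] [set: int] e.
Proof.
have : ([set: nat] #= [set: int])%card.
  rewrite card_eq_sym; apply: eq_card_nat => //.
  have : infinite_set (range Posz).
    move=> /(finite_preimage (f := Posz)).
    rewrite (_ : _ @^-1` _ = setT); last by apply/seteqP; split => // n _; exists n.
    by move=> h; apply: infinite_nat; apply: h => x y _ _ [].
  by apply: sub_infinite_set.
pose Z : pointedType := HB.pack int (isPointed.Build int 0).
by move=> /(@card_set_bijP _ Z).
Qed.

Local Open Scope ereal_scope.

Lemma measurable_shift (a : R) : measurable_fun setT (fun t : R => t + a)%R.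
Proof. by apply: measurable_funD. Qed.

Lemma measurable_esum_int (h : int -> R -> \bar R) :
  (forall n, measurable_fun setT (h n)) -> (forall n t, 0 <= h n t) ->
  measurable_fun setT (fun t => \esum_(n in [set: int]) h n t).
Proof.
move=> mh h0; have [e eb] := int_enumeration.
rewrite (_ : (fun t => _) = (fun t => \sum_(i <oo | i \in xpredT) h (e i) t)).
  by apply: ge0_emeasurable_sum.
by apply/funext => t; rewrite (@reindex_esum _ _ _ _ _ e (fun n => h n t) eb) -nneseries_esumT //.
Qed.

(** The intervals [[n a, (n + 1) a[] partition the line; each is shifted back to [[0, a[], and
    nonnegativity allows exchanging sum and integral. *)
Lemma integral_unfold_pos (a : R) (g : R -> \bar R) : (0 < a)%R ->
  measurable_fun setT g -> (forall t, 0 <= g t) ->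
  \int[leb]_t g t =
  \int[leb]_(t in `[0%R, a[) \esum_(n in [set: int]) g (t + n%:~R * a)%R.
Proof.
move=> a0 mg g0; have [e eb] := int_enumeration.
pose D (n : int) := `[(n%:~R * a)%R, ((n + 1)%:~R * a)%R[%classic : set R.
have mD n : measurable (D n) by exact: measurable_itv.
have Dt n t : D n t = (Num.floor (t / a) = n).
  rewrite /D /= in_itv /= -ler_pdivlMr // -ltr_pdivrMr // -floor_eq.
  by apply/propext; split=> /eqP.
have DT : \bigcup_i D (e i) = setT.
  apply/seteqP; split=> // t _.
  have [i _ ei] := set_bij_surj eb (I : [set: int] (Num.floor (t / a))).
  by exists i => //; rewrite Dt.
have tD : trivIset setT (fun i => D (e i)).
  move=> i j _ _ [t []]; rewrite !Dt => ei ej.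
  by apply: (set_bij_inj eb); rewrite ?inE // -ei -ej.
rewrite -[LHS]/(\int[leb]_(t in setT) g t) -DT ge0_integral_bigcup //; last by rewrite DT.
under [RHS]eq_integral do rewrite (@reindex_esum _ _ _ _ _ e _ eb) -nneseries_esumT //.
rewrite integral_nneseries //; last first.
  move=> n; apply: measurable_funTS.
  exact: (measurableT_comp mg (measurable_shift _)).
apply: eq_eseriesr => i _.
rewrite integral_mkcond [RHS]integral_mkcond.
rewrite -(@ge0_integral_shift _ ((e i)%:~R * a)).
- apply: eq_integral => t _; rewrite !patchE.
  suff -> : (t + (e i)%:~R * a \in D (e i))%R = (t \in `[0%R, a[%classic) by [].
  apply/idP/idP; rewrite !inE /D /= !in_itv /= intrD mulrDl mul1r; lra.
- by have /(measurable_restrictT g) [+ _] := mD (e i); apply; exact: measurable_funTS.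
- by move=> t; rewrite patchE; case: ifP.
- by move=> k; exact: mD.
Qed.

Lemma reindex_esum_int_opp (h : int -> \bar R) :
  \esum_(n in [set: int]) h n = \esum_(n in [set: int]) h (- n)%R.
Proof.
apply: (@reindex_esum _ _ _ _ _ -%R); split=> [n //|x y _ _ /oppr_inj //|n _].
by exists (- n)%R => //; rewrite opprK.
Qed.

Lemma integral_unfold (a : R) (g : R -> \bar R) : (a != 0)%R ->
  measurable_fun setT g -> (forall t, 0 <= g t) ->
  \int[leb]_t g t =
  \int[leb]_(t in `[0%R, `|a|%R[) \esum_(n in [set: int]) g (t + n%:~R * a)%R.
Proof.
move=> a0 mg g0; rewrite (@integral_unfold_pos `|a|) ?normr_gt0 //.
apply: eq_integral => t _; have [//|_] := ger0P a.
by rewrite reindex_esum_int_opp; apply: eq_esum => n _; rewrite mulrNz mulrNN.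
Qed.

Lemma esum_int_cst (c : \bar R) : 0 <= c ->
  \esum_(n in [set: int]) c < +oo -> c = 0.
Proof.
rewrite le_eqVlt => /predU1P[//|c0].
have [e eb] := int_enumeration.
rewrite (@reindex_esum _ _ _ _ _ e (fun=> c) eb) -nneseries_esumT; last by move=> _; exact: ltW.
(* As [c] may be infinite, a positive real [r <= c] is used; the partial sums [r *+ n] exceed every
   real bound. *)
have [r r0 rc] : exists2 r : R, (0 < r)%R & r%:E <= c.
  case: c c0 => [r r0|_|//]; first by exists r.
  by exists 1%R => //; rewrite leey.
set S := limn _; have rS n : (r *+ n)%:E <= S.
  apply: le_trans (nneseries_lim_ge n _); last by move=> *; exact: ltW.
  rewrite big_mkord -[n in (r *+ n)%R]card_ord -sumr_const -sumEFin.
  by apply: lee_sum => i _.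
case: S rS => [s rS _|//|/(_ 0%N) //].
have s0 : (0 <= s)%R by have := rS 0%N; rewrite lee_fin.
have := archi_boundP (divr_ge0 s0 (ltW r0)).
rewrite ltr_pdivrMr // mulr_natl => /lt_le_trans.
by move/(_ _ (rS _)); rewrite ltxx.
Qed.

End Unfolding.

(** * Kernels of lattice time-frequency operators *)

Section Fibres.
Variable R : realType.
Local Notation C := R[i].
Local Notation modulus := (@ComplexField.Normc.normc R).

Lemma normr_sqr_modulus (x : C) : `|x| ^+ 2 = (modulus x ^+ 2)%:C%C.
Proof. by rewrite rmorphXn. Qed.

Lemma recurrence_energy_real m L (a : nat -> nat -> C) :
  (forall n, a n m != 0) ->
  exists w : 'I_L -> R, [/\ forall n, 0 <= w n, \sum_n w n <= m%:R &
    forall v : nat -> C, (forall n, \sum_(k < m.+1) a n k * v (n + k)%N = 0) ->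
      \sum_(n < L) modulus (v n) ^+ 2 <= 1 ->
      forall n : 'I_L, modulus (v n) ^+ 2 <= w n].
Proof.
move=> am; have [w [w0 wm wP]] := recurrence_energy L am.
have wE n : w n = (complex.Re (w n))%:C%C.
  by have := w0 n; rewrite lecE; case: (w n) => x y /= /andP[/eqP ->].
exists (fun n => complex.Re (w n)); split.
- by move=> n; have := w0 n; rewrite lecE => /andP[].
- rewrite -lecR rmorph_sum rmorph_nat (eq_bigr w) //.
move=> v vsol v1 n; rewrite -lecR -wE -normr_sqr_modulus; apply: wP => //.
by rewrite -[1]/(1%:C)%C; under eq_bigr do rewrite normr_sqr_modulus; rewrite -rmorph_sum lecR.
Qed.

(** A finite set of indices fits in a window, where [recurrence_energy_real] gives weights depending
    on the recurrence alone. They bound all [u j] at once, hence also the supremum over [j]. *)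
Lemma fibre_energy m (J : Type) (a : int -> nat -> C) (u : J -> int -> C) :
  (forall n, a n m != 0) ->
  (forall j n, \sum_(k < m.+1) a n k * u j (n + k%:Z) = 0) ->
  (forall j L (n : int), \sum_(i < L) modulus (u j (n + i%:Z)) ^+ 2 <= 1) ->
  (\esum_(n in [set: int])
     ereal_sup (range (fun j => (modulus (u j n) ^+ 2)%:E)) <= (m%:R)%:E)%E.
Proof.
move=> am usol u1; apply: ge_ereal_sup => _ [X [finX _] <-].
rewrite fsbig_finite //=; set s : seq int := fset_set X.
have us : uniq s by exact: fset_uniq.
(* The window is [[-M, M]], with [L = 2 M + 1] points. *)
pose M := (\sum_(n <- s) `|n|)%N; pose L := (M + M).+1.
have sM n : n \in s -> (`|n| <= M)%N.
  by move=> ns; rewrite /M (big_rem n) //= leq_addr.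
have [w [wge0 wm wP]] := @recurrence_energy_real m L
  (fun i k => a (i%:Z - M%:Z) k) (fun i => am _).
pose h (n : int) : 'I_L := inord (absz (n + M%:Z)).
have hE n : n \in s -> (h n)%:Z - M%:Z = n.
  by move=> /sM ns; rewrite inordK /L; lia.
have w0 j n : modulus (u j ((n : 'I_L)%:Z - M%:Z)) ^+ 2 <= w n.
  have := wP (fun i => u j (i%:Z - M%:Z)); apply.
    move=> i; rewrite -[RHS](usol j (i%:Z - M%:Z)); apply: eq_bigr => k _.
    by congr (_ * u j _); lia.
  rewrite (eq_bigr (fun i : 'I_L => modulus (u j (- M%:Z + i%:Z)) ^+ 2)) ?u1 //.
  by move=> i _; congr (modulus (u j _) ^+ 2); lia.
apply: (@le_trans _ _ (\sum_(n <- s) w (h n))%:E).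
  rewrite -sumEFin !big_seq; apply: lee_sum => n ns.
  by apply: ge_ereal_sup => _ [j _ <-]; rewrite lee_fin -{1}(hE n ns).
rewrite lee_fin; apply: le_trans wm.
rewrite -(big_map h xpredT w) big_uniq /=; last first.
  rewrite map_inj_in_uniq // => x y xs ys /(congr1 (fun i : 'I_L => i%:Z - M%:Z)).
  by rewrite !hE.
rewrite [leRHS](bigID (mem (map h s))) /= -[leLHS](addr0) lerD2l.
by apply: sumr_ge0.
Qed.

End Fibres.

Section Kernel.
Variable R : realType.
Local Notation C := R[i].
Local Notation leb := (@lebesgue_measure R).
Local Notation modulus := (@ComplexField.Normc.normc R).

(** Terms are grouped by time shift, raised by [K] to be nonnegative. With [m] the largest raised
    shift carrying a nonzero coefficient, [a t m] is a nonzero trigonometric polynomial. The period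
    is [1 / beta] because [expi] is 1 at integers. *)
Lemma time_frequency_recurrence (alpha beta : R) (S : seq (int * int))
    (d : int * int -> C) (p0 : int * int) :
  beta != 0 -> uniq S -> p0 \in S -> d p0 != 0 ->
  exists (m : nat) (K : int) (a : R -> nat -> C),
  [/\ forall t (j : int) k, a (t + j%:~R / beta) k = a t k,
      \forall t \ae leb, a t m != 0 &
      forall (F : R -> C) t,
        \sum_(p <- S) d p * expi (p.2%:~R * beta * t) * F (t + p.1%:~R * alpha) =
        \sum_(k < m.+1) a t k * F (t + (k%:Z - K)%:~R * alpha)].
Proof.
move=> b0 uS p0S dp0; pose K := (\sum_(p <- S) `|p.1|)%N.
pose h (p : int * int) := absz (p.1 + K%:Z).
have hE p : p \in S -> (h p)%:Z = p.1 + K%:Z.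
  move=> pS; have : (`|p.1| <= K)%N by rewrite /K (big_rem p) //= leq_addr.
  by move=> pK; rewrite /h gez0_abs //; move: pK; case: (p.1) => n; lia.
pose Q n := has (fun p => (h p == n) && (d p != 0)) S.
have exQ : exists n, Q n.
  by exists (h p0); apply/hasP; exists p0 => //; rewrite eqxx.
have ubQ n : Q n -> (n <= \sum_(p <- S) h p)%N.
  by move=> /hasP[p pS /andP[/eqP <- _]]; rewrite (big_rem p) //= leq_addr.
case: (ex_maxnP exQ ubQ) => m /hasP[p1 p1S /andP[/eqP hp1 dp1]] mP.
pose a t k := \sum_(p <- S) (d p * expi (p.2%:~R * beta * t)) *+ (h p == k).
exists m, K%:Z, a; split.
- move=> t j k; apply: eq_bigr => p _; congr (_ * _ *+ _).
  rewrite mulrDr expiD [_ * (_ / _)](_ : _ = (p.2 * j)%:~R) ?expi_int ?mulr1 //.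
  by rewrite intrM; field.
(* [S1] lists the frequencies occurring with the top time shift; that of [p1] has a nonzero
   coefficient. *)
- pose S1 := [seq p.2 | p <- S & p.1 == p1.1].
  have uS1 : uniq S1.
    rewrite map_inj_in_uniq ?filter_uniq // => -[x y] [x' y'].
    by rewrite !mem_filter /= => /andP[/eqP -> _] /andP[/eqP -> _] ->.
  have p1S1 : p1.2 \in S1 by apply/mapP; exists p1; rewrite // mem_filter eqxx.
  have := @trig_poly_neq0_ae R beta S1 (fun l => d (p1.1, l)) p1.2 b0 uS1 p1S1.
  rewrite -surjective_pairing => /(_ dp1)/ae_mono; apply => t.
  rewrite big_map big_filter /a; congr (_ != _).
  rewrite big_mkcond /= !big_seq; apply: eq_bigr => -[k l] pS /=.
  have -> : (h (k, l) == m) = (k == p1.1).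
    rewrite -hp1; have := hE _ pS; have := hE _ p1S.
    by case: p1 {dp1 p1S1 hp1 p1S S1 uS1} => /= *; lia.
  by case: eqP => [->|_].
move=> F t; under [RHS]eq_bigr do rewrite mulr_suml.
rewrite exchange_big /= !big_seq; apply: eq_bigr => p pS.
have [hm|hm] := leqP (h p) m.
  rewrite (bigD1 (Ordinal (hm : (h p < m.+1)%N))) //= eqxx mulr1n big1 ?addr0.
    by rewrite hE // addrK.
  move=> i; rewrite -val_eqE /= eq_sym => /negbTE ->.
  by rewrite mulr0n mul0r.
(* By maximality of [m], larger shifts carry only zero coefficients. *)
have dp : d p = 0.
  apply/eqP; apply: contraT => dp; have /mP : Q (h p).
    by apply/hasP; exists p; rewrite // eqxx.
  by rewrite leqNgt hm.
by rewrite dp !mul0r big1 // => i _; rewrite mul0rn mul0r.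
Qed.

Lemma ae_lt_pinfty (D : set R) (g : R -> \bar R) : measurable D ->
  measurable_fun setT g -> (forall t, 0 <= g t)%E ->
  (\int[leb]_(t in D) g t < +oo)%E -> \forall t \ae leb, D t -> (g t < +oo)%E.
Proof.
move=> mD mg g0 gy.
have ig : leb.-integrable D g.
  apply/integrableP; split; first exact: measurable_funTS.
  by under eq_integral do rewrite gee0_abs //.
have := integrable_ae _ ig => /(_ mD)/ae_mono; apply=> t h Dt.
by rewrite -ge0_fin_numE // h.
Qed.

(* G = F / sqrt N is normalised on every coset t + alpha Z, where it solves a
   recurrence of bounded order. So rho, the supremum of |G|^2 over the
   translates by Z / beta, has bounded sums over these cosets, hence is
   integrable; being periodic, it vanishes. *)
Lemma time_frequency_kernel (alpha beta : R) (S : seq (int * int))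
    (d : int * int -> C) (p0 : int * int) (F : R -> C) :
  alpha != 0 -> beta != 0 -> uniq S -> p0 \in S -> d p0 != 0 ->
  measurable_cfun F -> (\int[leb]_t (modulus (F t) ^+ 2)%:E < +oo)%E ->
  (\forall t \ae leb,
     \sum_(p <- S) d p * expi (p.2%:~R * beta * t) * F (t + p.1%:~R * alpha) = 0) ->
  \forall t \ae leb, F t = 0.
Proof.
move=> a0 b0 uS p0S dp0 mF Fy Fsol.
have [m [K [a [aper am arec]]]] := time_frequency_recurrence alpha b0 uS p0S dp0.
pose g t := (modulus (F t) ^+ 2)%:E.
have mg : measurable_fun setT g.
  by apply/measurable_EFinP/measurable_funX/measurable_modulus.
have g0 t : (0 <= g t)%E by rewrite lee_fin sqr_ge0.
pose N t := (\esum_(n in [set: int]) g (t + n%:~R * alpha)%R)%E.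
have N0 t : (0 <= N t)%E by exact: esum_ge0.
have Nper t (k : int) : N (t + k%:~R * alpha) = N t.
  rewrite /N [RHS](@reindex_esum _ _ _ setT _ (fun n => k + n)).
    by apply: eq_esum => n _; rewrite intrD mulrDl addrA.
  split=> [//|x y _ _ /addrI //|n _].
  by exists (n - k) => //; rewrite addrC subrK.
have mN : measurable_fun setT N.
  apply: measurable_esum_int => // n.
  exact: (measurableT_comp mg (measurable_shift _)).
have Nge t L : ((\sum_(i < L) modulus (F (t + i%:Z%:~R * alpha)) ^+ 2)%R%:E <= N t)%E.
  have us : uniq [seq i%:Z | i <- iota 0 L].
    by rewrite map_inj_uniq ?iota_uniq // => ? ? [].
  apply: esum_ge; exists [set` [seq i%:Z | i <- iota 0 L]]; first by split; [exact: finite_seq|].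
  rewrite -fsbig_seq //.
  by rewrite big_map -sumEFin -val_enum_ord big_map big_enum.
(* By unfolding, the integral over one period of the coset energy [N] is that of [|F|^2], which is
   finite. *)
have Nfin : \forall t \ae leb, (N t < +oo)%E.
  apply: (ae_periodic a0) => [t Nt n|]; first by rewrite Nper.
  apply: ae_lt_pinfty => //.
  by rewrite -(integral_unfold a0 mg g0).
(* If [N t] is 0 or [+oo], then [fine (N t) = 0] and [nu t = 0], so [G] vanishes on the coset and
   its energy is still at most 1. *)
pose nu t := (Num.sqrt (fine (N t)))^-1.
pose G t := (nu t)%:C%C * F t.
pose gam t := modulus (G t) ^+ 2.
have gamE t : gam t = modulus (F t) ^+ 2 / fine (N t).
  rewrite /gam ComplexField.Normc.normcM exprMn mulrC; congr (_ * _).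
  rewrite modulusE /= expr0n addr0 sqr_sqrtr ?sqr_ge0 // /nu exprVn sqr_sqrtr //.
  exact: fine_ge0.
have mgam : measurable_fun setT (EFin \o gam).
  apply/measurable_EFinP.
  rewrite (_ : gam = (fun t => modulus (F t) ^+ 2) \*
      ((fun r => r `^ (-1)) \o (fine \o N))).
    apply: measurable_funM; first exact/measurable_funX/measurable_modulus.
    apply: measurableT_comp; first exact: measurable_powR.
    apply: measurableT_comp; last exact: mN.
    exact: fine_measurable.
  by apply/funext => t /=; rewrite gamE powR_inv1 // fine_ge0.
pose rho t := ereal_sup (range (fun j : int => (gam (t + j%:~R / beta))%:E)).
have gam_rho t : ((gam t)%:E <= rho t)%E.
  by apply: ereal_sup_ubound; exists 0 => //; rewrite mul0r addr0.
have rho0 t : (0 <= rho t)%E.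
  by apply: le_trans (gam_rho t); rewrite lee_fin sqr_ge0.
have rhoper t (k : int) : rho (t + k%:~R / beta) = rho t.
  congr ereal_sup; apply/seteqP; split=> _ [j _ <-].
    by exists (k + j) => //; rewrite intrD mulrDl addrA.
  by exists (j - k) => //; rewrite -addrA -mulrDl -intrD [_ + (j - k)]addrC subrK.
have mrho : measurable_fun setT rho.
  (* The supremum over [int] is taken over [nat] through [unpickle]; the default 0 adds no new
     value. *)
  pose f (i : nat) t := (gam (t + (odflt 0 (choice.unpickle i : option int))%:~R / beta))%:E.
  have -> : rho = (fun t => esups (f ^~ t) 0%N).
    apply/funext => t; congr ereal_sup; apply/seteqP; split=> [_ [j _ <-]|_ [i _ <-]].
      by exists (choice.pickle j) => //; rewrite /f choice.pickleK.
    by eexists.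
  apply: measurable_fun_esups => i.
  exact: (measurableT_comp mgam (measurable_shift _)).
have fibre : \forall t \ae leb,
    (\esum_(n in [set: int]) rho (t + n%:~R * alpha)%R <= (m%:R)%:E)%E.
  have h1 : \forall t \ae leb, forall n, a (t + n%:~R * alpha) m != 0.
    by apply: ae_forall_int => n; exact: (ae_shift (n%:~R * alpha) am).
  have h2 : \forall t \ae leb, forall n j : int,
      \sum_(p <- S) d p * expi (p.2%:~R * beta * (t + (n%:~R * alpha + j%:~R / beta))) *
        F (t + (n%:~R * alpha + j%:~R / beta) + p.1%:~R * alpha) = 0.
    apply: ae_forall_int => n; apply: ae_forall_int => j.
    exact: (ae_shift (n%:~R * alpha + j%:~R / beta) Fsol).
  have : \forall t \ae leb, (forall n, a (t + n%:~R * alpha) m != 0) /\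
    forall n j : int,
      \sum_(p <- S) d p * expi (p.2%:~R * beta * (t + (n%:~R * alpha + j%:~R / beta))) *
        F (t + (n%:~R * alpha + j%:~R / beta) + p.1%:~R * alpha) = 0.
    exact: ae_and.
  move/ae_mono; apply => t [tm tsol].
  (* The lowest shift in [arec] is [- K], so the recurrence is read at [t + (n + K) alpha] for its
     terms to start at index [n]. *)
  apply: (@fibre_energy _ m int (fun n k => a (t + (n + K)%:~R * alpha) k)
    (fun j n => G (t + n%:~R * alpha + j%:~R / beta))).
  - by move=> n; exact: tm.
  - move=> j n; pose s := t + ((n + K)%:~R * alpha + j%:~R / beta).
    have := tsol (n + K) j; rewrite -/s arec => /(congr1 (fun x => (nu s)%:C%C * x)).
    rewrite mulr0 mulr_sumr => s0; rewrite -[RHS]s0; apply: eq_bigr => k _.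
    (* The coefficients do not see [j / beta], so all translates solve the same recurrence; [nu],
       constant along each coset, preserves it. *)
    rewrite /s addrA aper -addrA -/s /G [RHS]mulrCA.
    have -> : t + (n + k%:Z)%:~R * alpha + j%:~R / beta = s + (k%:Z - K)%:~R * alpha.
      by rewrite /s !intrD mulrNz; ring.
    by rewrite /nu Nper.
  - move=> j L n; pose s := t + n%:~R * alpha + j%:~R / beta.
    rewrite (eq_bigr (fun i : 'I_L => modulus (F (s + i%:Z%:~R * alpha)) ^+ 2 / fine (N s))).
      rewrite -mulr_suml; have := N0 s; have := Nge s L.
      case: (N s) => [r||//] /=; last by rewrite invr0 mulr0.
      rewrite !lee_fin => Sr; rewrite le_eqVlt => /predU1P[<-|r0]; first by rewrite invr0 mulr0.
      by rewrite ler_pdivrMr ?mul1r.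
    move=> i _; rewrite -/(gam _) gamE.
    have -> : t + (n + i%:Z)%:~R * alpha + j%:~R / beta = s + i%:Z%:~R * alpha.
      by rewrite /s intrD; ring.
    by rewrite Nper.
have rhoy : (\int[leb]_t rho t < +oo)%E.
  rewrite (integral_unfold a0 mrho rho0).
  apply: (@le_lt_trans _ _ (\int[leb]_(t in `[0%R, `|alpha|%R[) (m%:R)%:E)%E).
    apply: ae_ge0_le_integral => //.
    - by move=> t _; exact: esum_ge0.
    - apply: measurable_funTS; apply: measurable_esum_int => // n.
      exact: (measurableT_comp mrho (measurable_shift _)).
    - exact: (ae_mono fibre (fun t h _ => h)).
  rewrite integral_cst //= lebesgue_measure_itv /= lte_fin normr_gt0 a0 -EFinB -EFinM.
  exact: ltry.
(* Unfolded along [1 / beta] instead, the same finite integral has as integrand the sum over [int]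
   of the constant [rho t], which is therefore 0 wherever that sum is finite. *)
have rhoz : \forall t \ae leb, rho t = 0%E.
  have b0' : beta^-1 != 0 by rewrite invr_eq0.
  apply: (ae_periodic b0') => [t rt n|]; first by rewrite rhoper.
  rewrite (integral_unfold b0' mrho rho0) in rhoy.
  have := ae_lt_pinfty _ _ _ rhoy => /(_ _ _ _)/ae_mono; apply.
  - exact: measurable_itv.
  - apply: measurable_esum_int => // n.
    exact: (measurableT_comp mrho (measurable_shift _)).
  - by move=> t; exact: esum_ge0.
  move=> t h /h; under eq_esum do rewrite rhoper.
  exact: esum_int_cst.
have : \forall t \ae leb, rho t = 0%E /\ (N t < +oo)%E by exact: ae_and.
move/ae_mono; apply => t [rt Nt].
apply: ComplexField.Normc.eq0_normc; apply/eqP; rewrite -sqrf_eq0.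
have := gam_rho t; rewrite rt lee_fin gamE => gt.
have : modulus (F t) ^+ 2 / fine (N t) == 0.
  by rewrite eq_le gt divr_ge0 ?sqr_ge0 ?fine_ge0.
rewrite mulf_eq0 invr_eq0 => /orP[//|Nt0].
(* If [fine (N t) = 0], the finite [N t] is itself 0, and so is its term [|F t|^2]. *)
have := Nge t 1%N; rewrite big_ord1 mul0r addr0 -[N t]fineK ?ge0_fin_numE //.
by rewrite (eqP Nt0) lee_fin eq_le sqr_ge0 andbT.
Qed.

End Kernel.

(** * Hilbert space structure of L2 *)

Section Hilbert.
Context d (T : measurableType d) (R : realType).
Variable mu : {measure set T -> \bar R}.
Local Notation C := R[i].
Local Notation re := (@complex.Re R).
Local Notation im := (@complex.Im R).
Local Notation modulus := (@ComplexField.Normc.normc R).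
Local Notation H := (L2 mu).
Local Notation Hfun := (L2fun mu).
Local Open Scope quotient_scope.

Lemma sqr_modulus (x : C) : modulus x ^+ 2 = re x ^+ 2 + im x ^+ 2.
Proof. by rewrite modulusE sqr_sqrtr // addr_ge0 ?sqr_ge0. Qed.

Lemma measurable_sqr_modulus (F : T -> C) : measurable_cfun F ->
  measurable_fun setT (fun t => (modulus (F t) ^+ 2)%:E).
Proof. by move=> mF; apply/measurable_EFinP/measurable_funX/measurable_modulus. Qed.

Lemma l2normeE (F : T -> C) :
  l2norme mu F = ((\int[mu]_t (modulus (F t) ^+ 2)%:E) `^ 2^-1)%E.
Proof.
rewrite /l2norme unlock /Lnorm; congr (_ `^ _)%E; apply: eq_integral => t _.
by rewrite poweR_EFin /= ger0_norm ?modulus_ge0 // powR_mulrn ?modulus_ge0.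
Qed.

Lemma sqintP (F : T -> C) : F \in sqint mu <->
  measurable_cfun F /\ (\int[mu]_t (modulus (F t) ^+ 2)%:E < +oo)%E.
Proof.
have h : (l2norme mu F < +oo <-> \int[mu]_t (modulus (F t) ^+ 2)%:E < +oo)%E.
  rewrite l2normeE.
  have : (0 <= \int[mu]_t (modulus (F t) ^+ 2)%:E)%E.
    by apply: integral_ge0 => t _; rewrite lee_fin sqr_ge0.
  case: (\int[mu]_t _)%E => [r||] // r0; first by rewrite poweR_EFin !ltry.
  by rewrite poweRyr ?invr_neq0.
split; first by move/asboolP => [? /h ?].
by move=> [? /h ?]; apply/asboolP.
Qed.

Lemma measurable_L2fun (F : Hfun) : measurable_cfun F.
Proof. by have [] := (sqintP F).1 (l2valP F). Qed.

Lemma integral_sqr_fin (F : Hfun) :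
  (\int[mu]_t (modulus (F t) ^+ 2)%:E)%E \is a fin_num.
Proof.
have [_ Fy] := (sqintP F).1 (l2valP F).
by rewrite ge0_fin_numE // integral_ge0 // => t _; rewrite lee_fin sqr_ge0.
Qed.

(** The norm of [H] is valued in [R[i]]; its square is moved to [R] for ordered arithmetic. *)
Definition L2sqr (u : H) : R := re `|u| ^+ 2.

Lemma L2_normE (u : H) : `|u| = (Num.sqrt (L2sqr u))%:C%C.
Proof.
have := normr_ge0 u; rewrite lecE /= => /andP[/eqP + u0].
rewrite sqrtr_sqr ger0_norm //; case: (`|u|) => x y /= ->; by [].
Qed.

Lemma L2sqr_ge0 (u : H) : 0 <= L2sqr u.
Proof. exact: sqr_ge0. Qed.

Lemma L2sqrE (F : Hfun) :
  L2sqr (\pi_H F) = fine (\int[mu]_t (modulus (F t) ^+ 2)%:E)%E.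
Proof.
have nF : `|\pi_H F| = (fine (l2norme mu F))%:C%C by exact: L2norm_pi.
rewrite /L2sqr nF /= l2normeE -(fineK (integral_sqr_fin F)).
have I0 : 0 <= fine (\int[mu]_t (modulus (F t) ^+ 2)%:E)%E.
  by apply/fine_ge0/integral_ge0 => t _; rewrite lee_fin sqr_ge0.
by rewrite poweR_EFin /= powR12_sqrt ?sqr_sqrtr.
Qed.

Lemma integrable_sqr_modulus (F : Hfun) :
  mu.-integrable setT (fun t => (modulus (F t) ^+ 2)%:E).
Proof.
have [mF Fy] := (sqintP F).1 (l2valP F).
apply/integrableP; split; first exact: measurable_sqr_modulus.
by under eq_integral do rewrite gee0_abs ?lee_fin ?sqr_ge0 //.
Qed.

(** Integrates a linear relation between squared moduli, which reduces the laws of the inner product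
    to [ring] identities in real and imaginary parts. *)
Lemma L2sqr_relation (s : seq (R * Hfun)) :
  (forall t, \sum_(x <- s) x.1 * modulus (x.2 t) ^+ 2 = 0) ->
  \sum_(x <- s) x.1 * L2sqr (\pi_H x.2) = 0.
Proof.
move=> s0; apply: EFin_inj.
transitivity (\int[mu]_t (\sum_(x <- s) x.1 * modulus (x.2 t) ^+ 2)%:E)%E; last first.
  by under eq_integral do rewrite s0; rewrite integral0.
under [RHS]eq_integral do rewrite -sumEFin.
rewrite -sumEFin integral_sum //.
  apply: eq_bigr => x _; under eq_integral do rewrite EFinM.
  by rewrite integralZl ?integrable_sqr_modulus // EFinM L2sqrE fineK ?integral_sqr_fin.
move=> x; under eq_fun do rewrite EFinM.
exact: integrableZl (integrable_sqr_modulus _).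
Qed.

(** By polarization, this is the real part of the complex inner product. *)
Definition L2dot (u v : H) : R := (L2sqr (u + v) - L2sqr u - L2sqr v) / 2.

Lemma ReD (x y : C) : re (x + y) = re x + re y. Proof. by rewrite raddfD. Qed.
Lemma ImD (x y : C) : im (x + y) = im x + im y. Proof. by rewrite raddfD. Qed.
Lemma ReM (x y : C) : re (x * y) = re x * re y - im x * im y.
Proof. by case: x y => ? ? []. Qed.
Lemma ImM (x y : C) : im (x * y) = re x * im y + im x * re y.
Proof. by case: x y => ? ? []. Qed.

Lemma add_cfunE (f g : T -> C) t : (f + g) t = f t + g t. Proof. by []. Qed.
Lemma opp_cfunE (f : T -> C) t : (- f) t = - f t. Proof. by []. Qed.
Lemma scale_cfunE c (f : T -> C) t : (c *: f) t = c * f t. Proof. by []. Qed.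

Lemma L2dotDl u v w : L2dot (u + v) w = L2dot u w + L2dot v w.
Proof.
elim/L2pi_ind: u => F; elim/L2pi_ind: v => G; elim/L2pi_ind: w => K.
(* The relation says that the third difference of a quadratic form vanishes. *)
pose s : seq (R * Hfun) := [:: (1, F + G + K); (- 1, F + G); (- 1, F + K);
  (- 1, G + K); (1, F); (1, G); (1, K)].
have /L2sqr_relation : forall t, \sum_(x <- s) x.1 * modulus (x.2 t) ^+ 2 = 0.
  move=> t; rewrite !big_cons big_nil /= !add_cfunE !sqr_modulus !(ReD, ImD).
  ring.
by rewrite !big_cons big_nil /L2dot -!L2piD /=; lra.
Qed.

Lemma L2dotC u v : L2dot u v = L2dot v u.
Proof. by rewrite /L2dot [u + v]addrC addrAC. Qed.

Lemma L2dot0l u : L2dot 0 u = 0.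
Proof. by have := L2dotDl 0 0 u; rewrite add0r; lra. Qed.

Lemma L2dotNl u v : L2dot (- u) v = - L2dot u v.
Proof. by apply/eqP; rewrite -addr_eq0 -L2dotDl addNr L2dot0l. Qed.

Lemma L2dot_suml (I : Type) (s : seq I) (F : I -> H) v :
  L2dot (\sum_(i <- s) F i) v = \sum_(i <- s) L2dot (F i) v.
Proof.
by elim: s => [|i s IH]; rewrite ?(big_nil, big_cons) ?L2dot0l // L2dotDl IH.
Qed.

Lemma L2dot_sumr (I : Type) (s : seq I) (F : I -> H) v :
  L2dot v (\sum_(i <- s) F i) = \sum_(i <- s) L2dot v (F i).
Proof. by rewrite L2dotC L2dot_suml; apply: eq_bigr => i _; rewrite L2dotC. Qed.

Lemma L2dotZl (c : C) u v : L2dot (c *: u) v = L2dot u (conjc c *: v).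
Proof.
elim/L2pi_ind: u => F; elim/L2pi_ind: v => G.
pose s : seq (R * Hfun) := [:: (1, c *: F + G); (- 1, c *: F); (- 1, G);
  (- 1, F + conjc c *: G); (1, F); (1, conjc c *: G)].
have /L2sqr_relation : forall t, \sum_(x <- s) x.1 * modulus (x.2 t) ^+ 2 = 0.
  move=> t; rewrite !big_cons big_nil /= !(add_cfunE, scale_cfunE).
  rewrite !sqr_modulus !(ReD, ImD, ReM, ImM).
  by case: c {s} => a b /=; ring.
by rewrite !big_cons big_nil /L2dot -!L2piZ -!L2piD /=; lra.
Qed.

Lemma L2sqrDZ (r : R) u v :
  L2sqr (u + r%:C%C *: v) = L2sqr u + 2 * r * L2dot u v + r ^+ 2 * L2sqr v.
Proof.
elim/L2pi_ind: u => F; elim/L2pi_ind: v => G.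
pose s : seq (R * Hfun) := [:: (1, F + r%:C%C *: G); (- (1 - r), F); (- r, F + G);
  (r - r ^+ 2, G)].
have /L2sqr_relation : forall t, \sum_(x <- s) x.1 * modulus (x.2 t) ^+ 2 = 0.
  move=> t; rewrite !big_cons big_nil /= !(add_cfunE, scale_cfunE).
  rewrite !sqr_modulus !(ReD, ImD, ReM, ImM) /=.
  ring.
by rewrite !big_cons big_nil /L2dot -!L2piZ -!L2piD /=; lra.
Qed.

Lemma L2_parallelogram u v :
  L2sqr (u + v) + L2sqr (u - v) = 2 * L2sqr u + 2 * L2sqr v.
Proof.
elim/L2pi_ind: u => F; elim/L2pi_ind: v => G.
pose s : seq (R * Hfun) := [:: (1, F + G); (1, F - G); (- 2, F); (- 2, G)].
have /L2sqr_relation : forall t, \sum_(x <- s) x.1 * modulus (x.2 t) ^+ 2 = 0.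
  move=> t; rewrite !big_cons big_nil /= !(add_cfunE, opp_cfunE).
  rewrite !sqr_modulus !(ReD, ImD, raddfN).
  ring.
by rewrite !big_cons big_nil /= raddfB L2piD /=; lra.
Qed.

Lemma L2sqr_dot u : L2dot u u = L2sqr u.
Proof.
have := L2_parallelogram u u; rewrite subrr /L2dot.
have -> : L2sqr 0 = 0 by rewrite /L2sqr normr0 expr0n.
lra.
Qed.

Lemma L2sqr_eq0 u : L2sqr u = 0 -> u = 0.
Proof.
by move=> u0; apply/eqP; rewrite -normr_eq0 L2_normE u0 sqrtr0.
Qed.

Lemma L2dot_isometry (U : {linear H -> H}) u v :
  (forall w, `|U w| = `|w|) -> L2dot (U u) (U v) = L2dot u v.
Proof. by move=> iso; rewrite /L2dot -linearD /L2sqr !iso. Qed.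

End Hilbert.

(** * Completeness of L2 *)

Section GeometricConvergence.
Variable R : realType.

Lemma ex_half_exp_lt (c e : R) : 0 < e -> exists N, c * 2^-1 ^+ N < e.
Proof.
move=> e0; exists (Num.bound (c / e)); set N := Num.bound _.
have : c / e < 2 ^+ N.
  exact: upper_nthrootP.
by rewrite exprVn ltr_pdivrMr // ltr_pdivrMr ?exprn_gt0 // mulrC.
Qed.

Lemma geometric_cvg (x : nat -> R) (c : R) :
  (forall k, `|x k.+1 - x k| <= c * 2^-1 ^+ k) ->
  x @ \oo --> limn x /\ forall n, `|x n - limn x| <= 2 * c * 2^-1 ^+ n.
Proof.
move=> xc.
have c0 : 0 <= c by have := le_trans (normr_ge0 _) (xc 0%N); rewrite expr0 mulr1.
have half p : (2^-1 : R) ^+ p.+1 = 2^-1 * 2^-1 ^+ p by rewrite exprS.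
(* The subtracted term makes the induction close; dropping it gives the uniform bound [xb]. *)
have tele n p : `|x (p + n)%N - x n| <= 2 * c * 2^-1 ^+ n - 2 * c * 2^-1 ^+ (p + n).
  elim: p => [|p IH]; first by rewrite !subrr normr0.
  rewrite addSn -[x _ - _](subrKA (x (p + n)%N)) half.
  by apply: le_trans (ler_normD _ _) _; have := xc (p + n)%N; lra.
have xb n m : (n <= m)%N -> `|x m - x n| <= 2 * c * 2^-1 ^+ n.
  move=> nm; have := tele n (m - n)%N; rewrite subnK // => /le_trans; apply.
  by rewrite gerBl !mulr_ge0 // exprn_ge0 // invr_ge0.
have xcvg : x @ \oo --> limn x.
  apply/cauchy_cvgP/cauchy_exP => e e0.
  have [N Ne] := ex_half_exp_lt (2 * c) e0.
  exists (x N); exists N => // n Nn; rewrite /= /ball /= distrC.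
  exact: le_lt_trans (xb _ _ Nn) Ne.
split=> // n; rewrite distrC ler_distl.
have near_n (P : nat -> Prop) : (forall m, (n <= m)%N -> P m) -> \forall m \near \oo, P m.
  by exists n.
apply/andP; split.
  apply: limr_ge; first by apply/cvg_ex; exists (limn x).
  by apply: near_n => m /xb; rewrite ler_distl => /andP[].
apply: limr_le; first by apply/cvg_ex; exists (limn x).
by apply: near_n => m /xb; rewrite ler_distl => /andP[].
Qed.

End GeometricConvergence.

Section Completeness.
Context d (T : measurableType d) (R : realType).
Variable mu : {measure set T -> \bar R}.
Local Notation C := R[i].
Local Notation re := (@complex.Re R).
Local Notation im := (@complex.Im R).
Local Notation modulus := (@ComplexField.Normc.normc R).
Local Notation H := (L2 mu).
Local Notation Hfun := (L2fun mu).
Local Open Scope quotient_scope.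

(** The Riesz-Fischer argument: [S], the sum of the [4^k |F (k + 1) - F k|^2], has integral at most
    the sum of the [4^k 8^-k], namely 2. Where [S] is finite, the increments are at most
    [sqrt S 2^-k], so the functions converge pointwise at a geometric rate. *)
Lemma L2_complete_geometric (F : nat -> Hfun) :
  (forall k, L2sqr (\pi_H (F k.+1) - \pi_H (F k)) <= 8^-1 ^+ k) ->
  exists G : Hfun, forall n, L2sqr (\pi_H (F n) - \pi_H G) <= 16 * 4^-1 ^+ n.
Proof.
move=> Fk.
pose g k t := (4 ^+ k * modulus ((F k.+1 - F k) t) ^+ 2)%:E.
have g0 k t : (0 <= g k t)%E by rewrite lee_fin mulr_ge0 ?sqr_ge0 ?exprn_ge0.
have mg k : measurable_fun setT (g k).
  apply/measurable_EFinP/measurable_funM => //.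
  apply/measurable_funX/measurable_modulus.
  exact: (measurable_L2fun (F k.+1 - F k)).
pose S t := (\sum_(k <oo) g k t)%E.
have S0 t : (0 <= S t)%E by exact: nneseries_ge0.
have mS : measurable_fun setT S by exact: ge0_emeasurable_sum.
have Sint : (\int[mu]_t S t <= 2%:E)%E.
  rewrite integral_nneseries //.
  apply: (lime_le (is_cvg_nneseries _)) => [k _ _|]; first exact: integral_ge0.
  apply: nearW => n; rewrite big_mkord.
  apply: (@le_trans _ _ (\sum_(k < n) (2^-1 ^+ k)%:E)%E).
    apply: lee_sum => k _; rewrite /g.
    under eq_integral do rewrite EFinM.
    rewrite ge0_integralZl_EFin ?exprn_ge0 //; last first.
    - exact/measurable_sqr_modulus/(measurable_L2fun (F k.+1 - F k)).
    - by move=> t _; rewrite lee_fin sqr_ge0.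
    rewrite -(fineK (integral_sqr_fin _)) -L2sqrE -EFinM lee_fin raddfB.
    have -> : (2^-1 : R) ^+ k = 4 ^+ k * 8^-1 ^+ k.
      by rewrite -exprMn; congr (_ ^+ k); field.
    rewrite ler_wpM2l ?exprn_ge0 //; exact: Fk.
  rewrite sumEFin lee_fin.
  suff -> : \sum_(k < n) (2^-1 : R) ^+ k = 2 - 2 * 2^-1 ^+ n.
    by rewrite gerBl mulr_ge0 // exprn_ge0 // invr_ge0.
  by elim: n => [|n IH]; rewrite ?big_ord0 ?big_ord_recr /= ?IH ?expr0 ?exprS; lra.
pose h t := Num.sqrt (fine (S t)).
have h2 t : h t ^+ 2 = fine (S t) by rewrite sqr_sqrtr // fine_ge0.
(* Replacing the values by 0 where [S] is infinite gives convergence everywhere, hence a measurable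
   limit. *)
pose X k t : C := if (S t < +oo)%E then F k t else 0.
have X2 t k : modulus (X k.+1 t - X k t) ^+ 2 <= (h t * 2^-1 ^+ k) ^+ 2.
  rewrite /X; case: ifPn => [Sy|_]; last first.
    by rewrite subrr sqr_modulus expr0n addr0 sqr_ge0.
  rewrite exprMn h2 exprAC -(ler_pM2l (_ : 0 < 4 ^+ k)) ?exprn_gt0 //.
  rewrite [leRHS]mulrCA -exprMn (_ : 4 * 2^-1 ^+ 2 = 1); last by field.
  rewrite expr1n mulr1 -lee_fin fineK ?ge0_fin_numE //.
  apply: le_trans (nneseries_lim_ge k.+1 (fun n _ _ => g0 n t)).
  rewrite big_mkord big_ord_recr /= leeDr //; exact: sume_ge0.
have h0 t : 0 <= h t by exact: sqrtr_ge0.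
have absle (x y c : R) : x ^+ 2 + y ^+ 2 <= c ^+ 2 -> 0 <= c -> `|x| <= c.
  move=> xyc c0; rewrite -(@ler_pXn2r _ 2) ?nnegrE // real_normK ?num_real //.
  by apply: le_trans xyc; rewrite lerDl sqr_ge0.
have reX t : forall k, `|re (X k.+1 t) - re (X k t)| <= h t * 2^-1 ^+ k.
  move=> k; rewrite -raddfB; apply: (@absle _ (im (X k.+1 t - X k t))).
    by rewrite -sqr_modulus.
  by rewrite mulr_ge0 // exprn_ge0 // invr_ge0.
have imX t : forall k, `|im (X k.+1 t) - im (X k t)| <= h t * 2^-1 ^+ k.
  move=> k; rewrite -raddfB; apply: (@absle _ (re (X k.+1 t - X k t))).
    by rewrite addrC -sqr_modulus.
  by rewrite mulr_ge0 // exprn_ge0 // invr_ge0.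
pose G t : C := Complex (limn (fun k => re (X k t))) (limn (fun k => im (X k t))).
have mX k : measurable_cfun (X k).
  have -> : X k = (fun t => (\1_[set t | (S t < +oo)%E] t)%:C%C) \* F k.
    apply/funext => t; rewrite /X /= indicE; case: ifPn => St.
      by rewrite mem_set // mul1r.
    by rewrite memNset ?mul0r //; apply/negP.
  apply: measurable_cfunM; last exact: (measurable_L2fun (F k)).
  split; last exact: measurable_cst.
  apply: measurable_indic.
  rewrite (_ : mkset _ = setT `&` S @^-1` [set` Interval -oo%O (BLeft +oo%E)]).
    by apply: mS => //; exact: emeasurable_itv.
  by rewrite setTI; apply/seteqP; split=> t /=; rewrite in_itv.
have mG : measurable_cfun G.
  split.
    apply: (@measurable_fun_cvg _ _ _ _ (fun k t => re (X k t))).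
      by move=> k; exact: (mX k).1.
    by move=> t _; exact: (geometric_cvg (reX t)).1.
  apply: (@measurable_fun_cvg _ _ _ _ (fun k t => im (X k t))).
    by move=> k; exact: (mX k).2.
  by move=> t _; exact: (geometric_cvg (imX t)).1.
have mNG : measurable_cfun (- G) by rewrite -scaleN1r; exact: measurable_cfunZ.
(* Real and imaginary parts each contribute [(2 h 2^-n)^2 = 4 h^2 4^-n]; where [S] is infinite the
   bound is trivial. *)
have GF n t : ((modulus (F n t - G t) ^+ 2)%:E <= (8 * 4^-1 ^+ n)%:E * S t)%E.
  have e0 : 0 < 8 * 4^-1 ^+ n :> R by rewrite mulr_gt0 // exprn_gt0 // invr_gt0.
  case: (ltP (S t) +oo%E) => [Sy|]; last first.
    by rewrite leye_eq => /eqP ->; rewrite gt0_muley ?lte_fin ?leey.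
  have XF k : X k t = F k t by rewrite /X Sy.
  rewrite -(fineK (_ : S t \is a fin_num)) ?ge0_fin_numE // -EFinM lee_fin -h2.
  have := (geometric_cvg (reX t)).2 n; have := (geometric_cvg (imX t)).2 n.
  rewrite XF sqr_modulus /G !raddfB /=.
  set x := _ - _; set y := _ - _ => yh xh.
  have sq (z : R) : `|z| <= 2 * h t * 2^-1 ^+ n -> z ^+ 2 <= 4 * 4^-1 ^+ n * h t ^+ 2.
    move=> zh; rewrite -real_normK ?num_real //.
    have -> : 4 * 4^-1 ^+ n * h t ^+ 2 = (2 * h t * 2^-1 ^+ n) ^+ 2.
      rewrite !exprMn [X in _ = _ * X]exprAC (_ : 2^-1 ^+ 2 = 4^-1 :> R); last by field.
      ring.
    by rewrite ler_pXn2r ?nnegrE // (le_trans (normr_ge0 _) zh).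
  by have := sq _ xh; have := sq _ yh; lra.
have intGF n : (\int[mu]_t (modulus (F n t - G t) ^+ 2)%:E <= (16 * 4^-1 ^+ n)%:E)%E.
  have e0 : 0 <= 8 * 4^-1 ^+ n :> R by rewrite mulr_ge0 // exprn_ge0 // invr_ge0.
  apply: (@le_trans _ _ (\int[mu]_t ((8 * 4^-1 ^+ n)%:E * S t))%E).
    apply: ge0_le_integral => //.
    - by move=> t _; rewrite lee_fin sqr_ge0.
    - apply: measurable_sqr_modulus; apply: measurable_cfunD.
        exact: (measurable_L2fun (F n)).
      exact: mNG.
    - by apply: emeasurable_funM => //; exact: measurable_cst.
  rewrite ge0_integralZl_EFin //.
  apply: (@le_trans _ _ ((8 * 4^-1 ^+ n)%:E * 2%:E)%E).
    by rewrite lee_wpmul2l // lee_fin.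
  by rewrite -EFinM lee_fin; lra.
have Gsq : G \in sqint mu.
  apply/sqintP; split=> //.
  have [mF0 F0y] := (sqintP mu _).1 (l2valP (F 0%N)).
  have mFG : measurable_cfun ((F 0%N : T -> C) - G).
    exact: measurable_cfunD.
  (* Square integrability comes from [|G|^2 <= 2 (|F 0|^2 + |F 0 - G|^2)]. *)
  apply: (@le_lt_trans _ _ (\int[mu]_t (2%:E * ((modulus (F 0%N t) ^+ 2)%:E +
      (modulus (F 0%N t - G t) ^+ 2)%:E)))%E).
    apply: ge0_le_integral => //.
    - by move=> t _; rewrite lee_fin sqr_ge0.
    - exact: measurable_sqr_modulus.
    - apply: emeasurable_funM; first exact: measurable_cst. apply: emeasurable_funD.
        exact: measurable_sqr_modulus.
      exact: (measurable_sqr_modulus mFG).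
    move=> t _; rewrite -EFinD -EFinM lee_fin !sqr_modulus !raddfB /=.
    set x := re _; set y := im _; set a := limn _; set b := limn _.
    have := sqr_ge0 (2 * x - a); have := sqr_ge0 (2 * y - b); nra.
  rewrite ge0_integralZl_EFin //; last 2 first.
  - by move=> t _; rewrite lee_fin addr_ge0 ?sqr_ge0.
  - apply: emeasurable_funD; first exact: measurable_sqr_modulus.
    exact: (measurable_sqr_modulus mFG).
  rewrite ge0_integralD //.
  - rewrite lte_mul_pinfty ?lee_fin // lte_add_pinfty //.
    by apply: le_lt_trans (intGF 0%N) _; exact: ltry.
  - by move=> t _; rewrite lee_fin sqr_ge0.
  - exact: measurable_sqr_modulus.
  - by move=> t _; rewrite lee_fin sqr_ge0.
  - exact: (measurable_sqr_modulus mFG).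
exists (MkL2fun Gsq) => n.
rewrite -raddfB L2sqrE -lee_fin fineK ?integral_sqr_fin //.
exact: intGF.
Qed.

End Completeness.

(** * Ranges and surjectivity *)

Section OperatorsOnL2.
Context d (T : measurableType d) (R : realType).
Variable mu : {measure set T -> \bar R}.
Local Notation C := R[i].
Local Notation H := (L2 mu).
Local Notation Hfun := (L2fun mu).
Local Open Scope quotient_scope.

Definition L2_tends (u : nat -> H) (v : H) : Prop :=
  forall e, 0 < e -> exists N, forall n, (N <= n)%N -> L2sqr (u n - v) <= e.

Lemma L2sqrD_le (u v : H) : L2sqr (u + v) <= 2 * L2sqr u + 2 * L2sqr v.
Proof. by have := L2_parallelogram u v; have := L2sqr_ge0 (u - v); lra. Qed.

Lemma L2sqrB_le (u v w : H) : L2sqr (u - w) <= 2 * L2sqr (u - v) + 2 * L2sqr (v - w).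
Proof. by rewrite -[u - w](subrKA v); exact: L2sqrD_le. Qed.

Lemma L2sqrN (u : H) : L2sqr (- u) = L2sqr u.
Proof. by rewrite /L2sqr normrN. Qed.

Lemma L2sqrZ (r : R) (u : H) : L2sqr (r%:C%C *: u) = r ^+ 2 * L2sqr u.
Proof.
have L0 : L2sqr (0 : H) = 0 by rewrite /L2sqr normr0 expr0n.
by rewrite -[_ *: u]add0r L2sqrDZ L2dot0l L0; ring.
Qed.

(** A subsequence with consecutive squared distances at most [8^-k] converges by the geometric case;
    the Cauchy property extends this to the whole sequence. *)
Lemma L2_complete (u : nat -> H) :
  (forall e, 0 < e -> exists N, forall m n, (N <= m)%N -> (N <= n)%N ->
     L2sqr (u m - u n) <= e) -> exists v, L2_tends u v.
Proof.
move=> uc; have e0 k : 0 < (8^-1 : R) ^+ k by rewrite exprn_gt0 // invr_gt0.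
have [N NP] := choice (fun k => uc _ (e0 k)).
(* The running maximum is monotone, so [phi k] and [phi k.+1] are both at least [N k]. *)
pose phi k := \max_(j < k.+1) N j.
have Nphi k : (N k <= phi k)%N by exact: (leq_bigmax (@ord_max k)).
have phiS k : (phi k <= phi k.+1)%N.
  by rewrite {2}/phi big_ord_recr /=; exact: leq_maxl.
have [G GP] : exists G : Hfun, forall k,
    L2sqr (\pi_H (repr (u (phi k))) - \pi_H G) <= 16 * 4^-1 ^+ k.
  apply: (@L2_complete_geometric _ _ _ _ (fun k => repr (u (phi k)))) => k.
  rewrite !reprK; apply: NP; last exact: Nphi.
  exact: leq_trans (Nphi k) (phiS k).
exists (\pi_H G) => e e_gt0.
have [k ke] := ex_half_exp_lt 64 e_gt0.
have k4 : (4^-1 : R) ^+ k <= 2^-1 ^+ k by rewrite lerXn2r ?nnegrE ?invr_ge0 //; lra.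
have k8 : (8^-1 : R) ^+ k <= 2^-1 ^+ k by rewrite lerXn2r ?nnegrE ?invr_ge0 //; lra.
have k2 : 0 <= (2^-1 : R) ^+ k by rewrite exprn_ge0 // invr_ge0.
exists (phi k) => n kn; apply: le_trans (L2sqrB_le _ (u (phi k)) _) _.
have := GP k; rewrite reprK => Gk.
have := NP k n (phi k) (leq_trans (Nphi k) kn) (Nphi k); lra.
Qed.

Lemma ex_invS_le (e : R) : 0 < e -> exists N, forall n, (N <= n)%N -> n.+1%:R^-1 <= e.
Proof.
move=> e0; exists (Num.bound e^-1) => n Nn; rewrite -[leRHS]invrK lef_pV2 ?posrE ?invr_gt0 //.
apply: ltW; apply: lt_le_trans (archi_boundP _) _; first by rewrite invr_ge0 ltW.
by rewrite ler_nat ltnW.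
Qed.

(* r, the component of u orthogonal to the range, is the limit of the residuals
   along a minimizing sequence. *)
Lemma range_projection (A : {linear H -> H}) (u : H) : exists (v : nat -> H) r,
  L2_tends (fun n => u - A (v n)) r /\ forall w, L2dot r (A w) = 0.
Proof.
pose E := [set L2sqr (u - A w) | w in [set: H]].
have E_inf : has_inf E.
  split; first by exists (L2sqr (u - A 0)), 0.
  by exists 0 => _ [w _ <-]; exact: L2sqr_ge0.
pose I := inf E.
have IE w : I <= L2sqr (u - A w) by apply: (ge_inf E_inf.2); exists w.
have near_inf n : exists w, L2sqr (u - A w) <= I + n.+1%:R^-1.
  have n0 : 0 < n.+1%:R^-1 :> R by rewrite invr_gt0.
  by have [_ [w _ <-] wn] := inf_adherent n0 E_inf; exists w; exact: ltW.
have [v vP] := choice near_inf; exists v.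
have rc : forall e, 0 < e -> exists N, forall m n, (N <= m)%N -> (N <= n)%N ->
    L2sqr ((u - A (v m)) - (u - A (v n))) <= e.
  move=> e e0; have e4 : 0 < e / 4 by rewrite divr_gt0.
  have [N NP] := ex_invS_le e4; exists N => m n Nm Nn.
  (* The midpoint of [v m] and [v n] is a competitor too, so the sum has squared norm at least
     [4 I]; the difference keeps at most [2 / (m + 1) + 2 / (n + 1)]. *)
  have := L2_parallelogram (u - A (v m)) (u - A (v n)).
  have -> : u - A (v m) + (u - A (v n)) =
      (2 : R)%:C%C *: (u - A ((2^-1 : R)%:C%C *: (v m + v n))).
    rewrite linearZ linearD /= scalerBr scalerA -rmorphM /= divff // scale1r.
    by rewrite rmorph_nat scaler_nat mulr2n opprD addrACA.
  rewrite L2sqrZ; have := IE ((2^-1 : R)%:C%C *: (v m + v n)).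
  by have := vP m; have := vP n; have := NP _ Nm; have := NP _ Nn;
    move: (n.+1%:R^-1) (m.+1%:R^-1) => p q; lra.
have [r rP] := L2_complete rc; exists r; split=> // w.
(* Minimality gives a quadratic inequality in [s] for the residual [rn]; passing to its limit [r]
   costs another [s^2 |A w|^2], whence the second factor 2. *)
have key s : 0 <= 2 * s * L2dot r (A w) + 2 * s ^+ 2 * L2sqr (A w).
  apply/ler_addgt0Pr => e e0.
  have e2 : 0 < e / 2 by rewrite divr_gt0.
  have [N1 h1] := ex_invS_le e2; have [N2 h2] := rP _ e2.
  pose n := maxn N1 N2.
  have := h1 n (leq_maxl _ _); have := h2 n (leq_maxr _ _); have := vP n.
  move: (n.+1%:R^-1) => q; set rn := u - A (v n) => a1 a2 a3.
  have b1 : I <= L2sqr (rn + s%:C%C *: A w).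
    have := IE (v n - s%:C%C *: w).
    by rewrite linearB linearZ /= opprB addrA addrAC.
  have b2 := L2sqr_ge0 ((rn - r) + (- s)%:C%C *: A w).
  rewrite L2sqrDZ in b1; rewrite L2sqrDZ L2dotDl L2dotNl in b2.
  nra.
have W0 := L2sqr_ge0 (A w); move: key W0; move: (L2dot _ _) (L2sqr _) => x W key W0.
have W1 : 0 < W + 1 by lra.
(* This [s] turns the bound into a negative multiple of [x^2]; [W + 1] instead of [W] avoids
   division by 0. *)
have := key (- x / (2 * (W + 1))).
have -> : 2 * (- x / (2 * (W + 1))) * x + 2 * (- x / (2 * (W + 1))) ^+ 2 * W =
   - (x ^+ 2 * ((W + 2) / (2 * (W + 1) ^+ 2))) by field; lra.
rewrite oppr_ge0 pmulr_lle0 ?divr_gt0 ?mulr_gt0 ?exprn_gt0 //; last by lra.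
move=> x2; apply/eqP; rewrite -sqrf_eq0 eq_le x2; exact: sqr_ge0.
Qed.

Lemma L2_norm_lt (u : H) (e : C) : 0 < e -> L2sqr u < complex.Re e ^+ 2 -> `|u| < e.
Proof.
case: e => x y; rewrite ltcE /= => /andP[/eqP -> x0] ux.
rewrite L2_normE ltcE /= eqxx /= -[x in _ < x](gtr0_norm x0) -sqrtr_sqr ltr_sqrt //.
by rewrite exprn_gt0.
Qed.

Lemma L2_tends_dense (S : set H) :
  (forall u, exists2 v : nat -> H, forall n, S (v n) & L2_tends v u) -> dense S.
Proof.
move=> hS O [u Ou] oO; have /nbhs_ballP[e /= e0 eO] : nbhs u O by exact: open_nbhs_nbhs.
have [v Sv vu] := hS u.
have e'0 : 0 < complex.Re e by move: e0; rewrite ltcE => /andP[].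
have e2 : 0 < complex.Re e ^+ 2 / 2 by rewrite divr_gt0 ?exprn_gt0.
have [N NP] := vu _ e2.
exists (v N); split=> //; apply: eO; rewrite -ball_normE /= distrC.
apply: L2_norm_lt => //; apply: le_lt_trans (NP N (leqnn N)) _.
by have := exprn_gt0 2 e'0; lra.
Qed.

Variable A : {linear H -> H}.

(** The component [r] of [u] orthogonal to the range satisfies [L2dot (A' r) (A' r) = L2dot (A (A'
    r)) r = 0], so it vanishes by injectivity of [A']. *)
Lemma range_dense (A' : H -> H) :
  (forall v w, L2dot (A v) w = L2dot v (A' w)) ->
  (forall w, A' w = 0 -> w = 0) ->
  forall u, exists v : nat -> H, L2_tends (fun n => A (v n)) u.
Proof.
move=> adj A'inj u; have [v [r [vr rA]]] := range_projection A u.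
have r0 : r = 0.
  by apply/A'inj/L2sqr_eq0; rewrite -L2sqr_dot -adj L2dotC rA.
exists v => e /vr[N NP]; exists N => n /NP.
by rewrite r0 subr0 -L2sqrN opprB.
Qed.

(** The lower bound makes the approximate preimages a Cauchy sequence, and the upper bound carries
    [A] through its limit. *)
Lemma bounded_below_surjective (a b : R) :
  0 < a -> (forall v, a * L2sqr v <= L2sqr (A v)) ->
  (forall v, L2sqr (A v) <= b * L2sqr v) ->
  (forall u, exists v : nat -> H, L2_tends (fun n => A (v n)) u) ->
  forall u, exists v, A v = u.
Proof.
move=> a0 Aa Ab Ad u; have [v vu] := Ad u.
have bsq (w : H) : b * L2sqr w <= `|b| * L2sqr w.
  by rewrite ler_wpM2r ?L2sqr_ge0 // ler_norm.
have [w wv] : exists w, L2_tends v w.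
  apply: L2_complete => e e0; have ae0 : 0 < a * e / 4 by rewrite divr_gt0 ?mulr_gt0.
  have [N NP] := vu _ ae0; exists N => m n Nm Nn.
  rewrite -(ler_pM2l a0); apply: le_trans (Aa _) _; rewrite linearB.
  apply: le_trans (L2sqrB_le _ u _) _.
  have := NP _ Nm; have := NP _ Nn; rewrite -[L2sqr (u - _)]L2sqrN opprB; lra.
exists w; apply/eqP; rewrite -subr_eq0; apply/eqP/L2sqr_eq0/eqP.
rewrite eq_le L2sqr_ge0 andbT; apply/ler_addgt0Pr => e e0; rewrite add0r.
have b1 : 0 < `|b| + 1 by rewrite ltr_wpDl.
have e1 : 0 < e / (4 * (`|b| + 1)) by rewrite divr_gt0 ?mulr_gt0.
have e4 : 0 < e / 4 by rewrite divr_gt0.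
have [N1 h1] := wv _ e1; have [N2 h2] := vu _ e4.
pose n := maxn N1 N2; have := h1 n (leq_maxl _ _); have := h2 n (leq_maxr _ _).
move=> k2 k1; apply: le_trans (L2sqrB_le _ (A (v n)) _) _.
rewrite -[L2sqr (A w - _)]L2sqrN opprB -linearB.
have := Ab (v n - w); have := bsq (v n - w).
move: k1; rewrite ler_pdivlMr ?mulr_gt0 //; have := L2sqr_ge0 (v n - w).
lra.
Qed.

End OperatorsOnL2.

(** * The representation of the Heisenberg group ring *)

Section HeisenbergOperators.
Variables (R : realType) (alpha beta : R).
Local Notation C := R[i].
Local Notation leb := (@lebesgue_measure R).
Local Notation H := (L2 leb).
Local Notation Hfun := (L2fun leb).
Local Notation theta := (alpha * beta).
Local Notation rep := (heis_rep alpha beta).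
Local Open Scope quotient_scope.

Definition exponents (h : heis) : int * int := (heis_k h, heis_l h).

Lemma heis_sum_pi (s : seq heis) (c : heis -> C) (F : Hfun) :
  exists2 K : Hfun, \sum_(h <- s) c h *: rep h (\pi_H F) = \pi_H K &
    forall t, K t = \sum_(h <- s) c h * (expi ((heis_m h)%:~R * theta +
      (heis_l h)%:~R * beta * (t + (heis_k h)%:~R * alpha)) *
        F (t + (heis_k h)%:~R * alpha)).
Proof.
elim: s => [|h s [K KE Kt]].
  by exists 0 => [|t]; rewrite big_nil // raddf0.
have [G GE Gt] := heis_rep_pi alpha beta h F.
exists (c h *: G + K) => [|t]; first by rewrite big_cons KE GE -L2piZ -L2piD.
by rewrite big_cons -Kt -Gt.
Qed.

(** Any list of group elements is allowed, so that the adjoint is covered too. Collecting terms with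
    equal [(k, l)] leaves an operator to which [time_frequency_kernel] applies. *)
Lemma heis_sum_injective (s : seq heis) (c : heis -> C) (p0 : int * int) :
  theta != 0 ->
  \sum_(h <- s | exponents h == p0) c h * expi ((heis_m h)%:~R * theta) != 0 ->
  forall u : H, \sum_(h <- s) c h *: rep h u = 0 -> u = 0.
Proof.
rewrite mulf_eq0 negb_or => /andP[a0 b0] cp0; elim/L2pi_ind => F.
have [K -> Kt] := heis_sum_pi s c F.
rewrite -[X in _ = X](raddf0 (\pi_H)) => /L2_eqP K0.
pose D p := \sum_(h <- s | exponents h == p) c h * expi ((heis_m h)%:~R * theta).
(* The phase added to the twisted coefficient [D p] comes from the modulation being evaluated at
   [t + k alpha]. *)
pose d (p : int * int) := D p * expi ((p.2 * p.1)%:~R * theta).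
pose S := undup [seq exponents h | h <- s].
have p0S : p0 \in S.
  rewrite mem_undup; apply: contraNT cp0 => p0s; apply/eqP/big1_seq => h /andP[/eqP hp hs].
  by case/negP: p0s; apply/mapP; exists h.
have dp0 : d p0 != 0.
  by rewrite mulf_neq0 // -normr_eq0 normr_expi oner_eq0.
have [mF Fy] := (sqintP leb F).1 (l2valP F).
rewrite -[X in _ = X](raddf0 (\pi_H)); apply/L2_eqP.
have Fsol : \forall t \ae leb, \sum_(p <- S) d p * expi (p.2%:~R * beta * t) *
    F (t + p.1%:~R * alpha) = 0.
  apply: (ae_mono K0) => t /(_ I) Kt0; rewrite -[RHS]Kt0 Kt.
  transitivity (\sum_(p <- S) \sum_(h <- s) if exponents h == p then
      c h * (expi ((heis_m h)%:~R * theta +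
      (heis_l h)%:~R * beta * (t + (heis_k h)%:~R * alpha)) *
        F (t + (heis_k h)%:~R * alpha)) else 0).
    apply: eq_bigr => p _; rewrite /d /D -mulrA -mulrA mulr_suml -big_mkcond /=.
    apply: eq_bigr => h /eqP <-; rewrite /exponents /= !mulrA; congr (_ * _).
    by rewrite -!mulrA -!expiD; congr (_ * expi _); rewrite intrM; ring.
  rewrite exchange_big /= big_seq [RHS]big_seq; apply: eq_bigr => h hs.
  have hS : exponents h \in S by rewrite mem_undup map_f.
  rewrite (bigD1_seq (exponents h) hS (undup_uniq _)) /= eqxx big1 ?addr0 //.
  by move=> p; rewrite eq_sym => /negbTE ->.
have F0 := time_frequency_kernel a0 b0 (undup_uniq _) p0S dp0 mF Fy Fsol.
by apply: (ae_mono F0) => t Ft _.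
Qed.

Lemma twistE (g : malg heis C) p : (twist theta g)@_p =
  \sum_(h <- msupp g | exponents h == p) g@_h * expi ((heis_m h)%:~R * theta).
Proof.
rewrite /twist (raddf_sum (mcoeff p)) [RHS]big_mkcond /=.
by apply: eq_bigr => h _; rewrite mcoeffU; case: eqP.
Qed.

Lemma conjc_expi (s : R) : conjc (expi s) = expi (- s) :> C.
Proof. by rewrite /expi mulrN cosN sinN. Qed.

(** The action of the involution of the group ring, indexed by inverses to fit
    [heis_sum_injective]. *)
Definition adjoint_rep (g : malg heis C) (u : H) : H :=
  \sum_(h <- [seq h^-1%g | h <- msupp g]) conjc (g@_(h^-1)%g) *: rep h u.

(** The isometry [rep h^-1] preserves [L2dot] and undoes [rep h], while scalars move across
    conjugated. *)
Lemma adjoint_repP (g : malg heis C) (v w : H) :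
  L2dot (group_ring_rep alpha beta g v) w = L2dot v (adjoint_rep g w).
Proof.
rewrite /group_ring_rep L2dot_suml /adjoint_rep L2dot_sumr big_map.
apply: eq_bigr => h _; rewrite invgK L2dotZl.
rewrite -(@L2dot_isometry _ _ _ _ (rep h^-1%g)); last exact: heis_rep_isometry.
by rewrite /= -heis_repM mulVg heis_rep1 linearZ.
Qed.

Lemma heis_klm_inv (h : heis) :
  (exponents h^-1%g = (- heis_k h, - heis_l h)) *
  (heis_m h^-1%g = - (heis_m h + heis_k h * heis_l h)).
Proof.
rewrite /exponents /heis_k /heis_l /heis_m -[h^-1%g]/(heis_inv h) /heis_inv.
by rewrite !heis_coordK; split=> //; ring.
Qed.

Lemma ex_twist_neq0 (g : malg heis C) : twist theta g != 0 ->
  exists p, (twist theta g)@_p != 0.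
Proof.
move=> g0; apply: contrapT => h; case/negP: g0; apply/eqP/malgP => p.
by rewrite mcoeff0; apply/eqP; apply: contrapT => /negP gp; apply: h; exists p.
Qed.

Lemma group_ring_rep_injective (g : malg heis C) : theta != 0 ->
  twist theta g != 0 -> forall u : H, group_ring_rep alpha beta g u = 0 -> u = 0.
Proof.
move=> th0 /ex_twist_neq0[p]; rewrite twistE => gp.
exact: (heis_sum_injective th0 gp).
Qed.

(** Inversion sends [(k, l)] to [(- k, - l)] and [m] to [- (m + k l)], so the twisted coefficient of
    the adjoint at [(- k, - l)] is the conjugate of that of [g] at [(k, l)], up to a phase. *)
Lemma adjoint_rep_injective (g : malg heis C) : theta != 0 ->
  twist theta g != 0 -> forall u : H, adjoint_rep g u = 0 -> u = 0.
Proof.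
move=> th0 /ex_twist_neq0[[k l]]; rewrite twistE => gp.
apply: (@heis_sum_injective _ (fun h => conjc (g@_(h^-1)%g)) (- k, - l)) => //.
rewrite big_map.
have -> : \sum_(h <- msupp g | exponents h^-1%g == (- k, - l))
    conjc (g@_(h^-1^-1)%g) * expi ((heis_m h^-1%g)%:~R * theta) =
  conjc (\sum_(h <- msupp g | exponents h == (k, l)) g@_h * expi ((heis_m h)%:~R * theta)) *
    expi (- ((k * l)%:~R * theta)).
  rewrite rmorph_sum mulr_suml; apply: eq_big => h.
    by rewrite heis_klm_inv /exponents !xpair_eqE !eqr_opp.
  rewrite !heis_klm_inv xpair_eqE !eqr_opp => /andP[/eqP <- /eqP <-].
  rewrite invgK rmorphM -mulrA; congr (_ * _).
  rewrite -[X in _ = X * _]/(conjc (expi ((heis_m h)%:~R * theta))).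
  rewrite conjc_expi -expiD; congr expi.
  by rewrite mulrNz intrD; ring.
by rewrite mulf_neq0 ?conjc_eq0 // -normr_eq0 normr_expi oner_eq0.
Qed.

Lemma group_ring_repEw (D : {fset heis}) (g : malg heis C) (u : H) :
  (msupp g `<=` D)%fset ->
  group_ring_rep alpha beta g u = \sum_(h <- D) g@_h *: rep h u.
Proof.
move=> gD; apply: big_fset_incl => // h _ hg.
by rewrite mcoeff_outdom // scale0r.
Qed.

Lemma group_ring_rep_scalarB (c : C) (f : malg heis C) (u : H) :
  group_ring_rep alpha beta (c *: << 1%g >> - f) u = c *: u - group_ring_rep alpha beta f u.
Proof.
pose e : malg heis C := << 1%g >>.
(* A common support lets the three sums be compared term by term. *)
pose D := (msupp (c *: e - f) `|` msupp f `|` msupp e)%fset.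
rewrite (@group_ring_repEw D); last by rewrite /D -fsetUA fsubsetUl.
rewrite (@group_ring_repEw D f); last first.
  by rewrite /D [X in (_ `<=` X `|` _)%fset]fsetUC -fsetUA fsubsetUl.
have eE : group_ring_rep alpha beta e u = u.
  by rewrite /group_ring_rep msuppU oner_eq0 big_seq_fset1 mcoeffUU scale1r heis_rep1.
have -> : c *: u = c *: group_ring_rep alpha beta e u by rewrite eE.
rewrite (@group_ring_repEw D e); last by rewrite /D fsubsetUr.
rewrite scaler_sumr -sumrB; apply: eq_bigr => h _.
rewrite mcoeffB mcoeffZ scalerBl; congr (_ - _).
exact/esym/scalerA.
Qed.

End HeisenbergOperators.

(** Group elements act isometrically, so the operator norm is at most the l^1 norm of [g]. *)
Lemma group_ring_rep_bound (R : realType) (alpha beta : R) (g : malg heis R[i]) :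
  exists b : R, forall u, L2sqr (group_ring_rep alpha beta g u) <= b * L2sqr u.
Proof.
pose b := \sum_(h <- msupp g) ComplexField.Normc.normc g@_h; exists (b ^+ 2) => u.
have b0 : 0 <= b by apply: sumr_ge0 => h _; exact: modulus_ge0.
have : `|group_ring_rep alpha beta g u| <= (b * Num.sqrt (L2sqr u))%:C%C.
  apply: le_trans (ler_norm_sum _ _ _) _.
  rewrite rmorphM rmorph_sum mulr_suml /=; apply: ler_sum => h _.
  by rewrite normrZ heis_rep_isometry -L2_normE.
rewrite L2_normE lecR => h.
rewrite -[leLHS](sqr_sqrtr (L2sqr_ge0 _)) -[X in _ * X](sqr_sqrtr (L2sqr_ge0 _)) -exprMn.
by rewrite ler_pXn2r ?nnegrE ?mulr_ge0 ?sqrtr_ge0.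
Qed.

Lemma bounded_from_below_sqr d (T : measurableType d) (R : realType)
    (mu : {measure set T -> \bar R}) (A : L2 mu -> L2 mu) :
  bounded_from_below A ->
  exists2 a : R, 0 < a & forall v, a * L2sqr v <= L2sqr (A v).
Proof.
case=> -[x y]; rewrite ltcE /= => /andP[/eqP -> x0] Av.
exists (x ^+ 2); first by rewrite exprn_gt0.
move=> v; have := Av v; rewrite !L2_normE -[Complex x 0]/(x%:C%C) -rmorphM lecR => h.
rewrite -[leRHS](sqr_sqrtr (L2sqr_ge0 _)) -[X in _ * X](sqr_sqrtr (L2sqr_ge0 _)) -exprMn.
by rewrite ler_pXn2r ?nnegrE ?mulr_ge0 ?sqrtr_ge0 // ltW.
Qed.

Theorem theorem6p8 (R : realType) (alpha beta : R) (f : malg heis R[i]) :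
  alpha * beta != 0 ->
  twist (alpha * beta) f != 0 ->
  forall c : R[i],
    spectrum (group_ring_rep alpha beta f) c ->
    (* f^theta is not the constant c *)
    twist (alpha * beta) (c *: << 1%g >> - f) != 0 ->
    [/\ injective (group_ring_rep alpha beta (c *: << 1%g >> - f)),
        dense (range (group_ring_rep alpha beta (c *: << 1%g >> - f))) &
        ~ bounded_from_below (group_ring_rep alpha beta (c *: << 1%g >> - f))].
Proof.
move=> th0 _ c cspec; set g := (c *: << 1%g >> - f) => tg0.
pose A : {linear L2 (@lebesgue_measure R) -> L2 (@lebesgue_measure R)} :=
  group_ring_rep alpha beta g.
have inj : injective A.
  move=> u v uv; apply/eqP; rewrite -subr_eq0; apply/eqP.
  by apply: (group_ring_rep_injective th0 tg0); rewrite linearB /= uv subrr.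
have tends := @range_dense _ _ _ _ A (adjoint_rep alpha beta g)
  (adjoint_repP alpha beta g) (adjoint_rep_injective th0 tg0).
split=> //.
  apply: L2_tends_dense => u; have [v vu] := tends u.
  by exists (fun n => A (v n)) => // n; exists (v n).
(* A lower bound would make [A] invertible with inverse bounded by [delta^-1], and [c] a resolvent
   point. *)
move=> /[dup] -[delta d0 Ad] /bounded_from_below_sqr[a a0 Aa].
have [b Ab] := group_ring_rep_bound alpha beta g.
have surj := bounded_below_surjective a0 Aa Ab tends.
have [B0 AB] := choice surj.
have B0lin : linear B0 by move=> x u v; apply: inj; rewrite linearP !AB.
pose B : {linear L2 (@lebesgue_measure R) -> L2 (@lebesgue_measure R)} :=
  HB.pack B0 (GRing.isLinear.Build _ _ _ _ B0 B0lin).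
have AE v : A v = c *: v - group_ring_rep alpha beta f v.
  exact: group_ring_rep_scalarB.
apply: cspec; exists B; split.
- apply: bounded_linear_continuous; apply/bounded_funP => r.
  exists (delta^-1 * r) => u ur; rewrite ler_pdivlMl //.
  by apply: le_trans (Ad _) _; rewrite [X in `|X|]AB.
- by move=> v; apply: inj; rewrite -AE; exact: AB.
- by move=> v; rewrite -AE; exact: AB.
Qed.
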